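(* For every integer $k\geq 2$, the curve $\mathcal{V}_{k,1}\subset\mathcal{M}_2$, consisting of the Möbius conjugacy classes of quadratic rational maps having a critical point that is preperiodic to a fixed point with preperiod $k$, is irreducible.
   Context: For a rational map $f:\mathbb{C}\mathbb{P}^1\to\mathbb{C}\mathbb{P}^1$, a point $z$ is periodic with period $n\geq 1$ if $f^{\circ n}(z)=z$ and $n$ is the least such integer; $z$ is preperiodic with preperiod $k\geq 0$ if $f^{\circ k}(z)$ is periodic and $k$ is the least such integer. A point is preperiodic to a cycle of period $n$ with preperiod $k$ if it is preperiodic with preperiod $k$ and $f^{\circ k}(z)$ has period $n$ (for $n=1$: preperiodic to a fixed point). $\mathcal{M}_2$ is the moduli space of Möbius conjugacy classes of complex rational maps of degree $2$; it is isomorphic to $\mathbb{C}^2$ (the class of $f$ is determined by $(\sigma_1,\sigma_2)\in\mathbb{C}^2$, the first two elementary symmetric functions of the multipliers of the three fixed points of $f$ counted with multiplicity). For $k\geq 0$ with $k\neq 1$ and $n\geq 1$, $\mathcal{V}_{k,n}\subset\mathcal{M}_2$ denotes the set of classes of quadratic rational maps that have a critical point preperiodic to a cycle of period $n$ with preperiod $k$. Irreducible means irreducible for the topology induced by the Zariski topology of $\mathcal{M}_2\cong\mathbb{C}^2$: $\mathcal{V}_{k,1}$ is nonempty and is not the union of two proper relatively Zariski-closed subsets. *)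

(* Defs.v *)
From HB Require Import structures.
From mathcomp Require Import all_boot all_order all_algebra.
From mathcomp Require Import boolp classical_sets reals.
From mathcomp Require Import complex.
From mathcomp Require Import mpoly.

Set Implicit Arguments.
Unset Strict Implicit.
Unset Printing Implicit Defensive.

Local Open Scope ring_scope.
Local Open Scope classical_set_scope.

(* The projective line: [None] is the point at infinity. *)
Notation P1 C := (option C).

(* A rational map num / den in lowest terms. The pair is only determined up to
   a common scalar; equality of maps is always meant pointwise on P1, and
   [moduli_class] identifies proportional pairs (conjugate by the identity). *)
Record ratmap (C : closedFieldType) := Ratmap {
  num : {poly C};
  den : {poly C};
  num_den_coprime : coprimep num den
}.

Section RationalMaps.
Variable C : closedFieldType.
Implicit Types (f g phi : ratmap C) (z : P1 C).

Definition degree f : nat := (maxn (size (num f)) (size (den f))).-1.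

(* At infinity, f takes the value [a : b], where a and b are the (possibly
   zero) coefficients of degree [degree f] of num and den. *)
Definition ratmap_eval f z : P1 C :=
  let ab := match z with
            | Some x => ((num f).[x], (den f).[x])
            | None => ((num f)`_(degree f), (den f)`_(degree f))
            end in
  if ab.2 == 0 then None else Some (ab.1 / ab.2).

(* w ^ degree f * num (1 / w) and w ^ degree f * den (1 / w), as polynomials in
   the coordinate w = 1 / z at infinity, in which infinity is w = 0. *)
Definition num_infty f : {poly C} :=
  \poly_(i < (degree f).+1) (num f)`_(degree f - i).
Definition den_infty f : {poly C} :=
  \poly_(i < (degree f).+1) (den f)`_(degree f - i).

Definition wronskian (p q : {poly C}) : {poly C} := p^`() * q - p * q^`().

(* (p / q)' = wronskian p q / q ^ 2 and (q / p)' = - wronskian p q / p ^ 2; one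
   of these is the derivative of f in local coordinates, according to whether
   the value of f is finite or infinite. *)
Definition critical_point f z : Prop :=
  match z with
  | Some x => root (wronskian (num f) (den f)) x
  | None => root (wronskian (num_infty f) (den_infty f)) 0
  end.

(* The derivative of f at a fixed point z; at infinity, it is the derivative at
   w = 0 of w |-> 1 / f (1 / w) = den_infty f / num_infty f. *)
Definition multiplier f z : C :=
  match z with
  | Some x => (wronskian (num f) (den f)).[x] / (den f).[x] ^+ 2
  | None => (wronskian (den_infty f) (num_infty f)).[0]
              / (num_infty f).[0] ^+ 2
  end.

(* The degree f + 1 fixed points with multiplicity: the finite ones are the
   roots of num - 'X * den, and infinity accounts for the drop in degree. *)
Definition fixed_points f : seq (P1 C) :=
  let F := num f - 'X * den f in
  map Some (sval (closed_field_poly_normal F))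
    ++ nseq ((degree f).+1 - (size F).-1) None.

Definition sigma (k : nat) f : C :=
  (mesym (size (fixed_points f)) C k).@[
    fun i => multiplier f (tnth (in_tuple (fixed_points f)) i)].

Definition has_period f (n : nat) z : Prop :=
  [/\ (0 < n)%N, iter n (ratmap_eval f) z = z &
      forall m, (0 < m < n)%N -> iter m (ratmap_eval f) z <> z].

Definition periodic f z : Prop := exists n, has_period f n z.

Definition has_preperiod f (k : nat) z : Prop :=
  periodic f (iter k (ratmap_eval f) z) /\
  forall j, (j < k)%N -> ~ periodic f (iter j (ratmap_eval f) z).

Definition preperiodic_to_cycle f (k n : nat) z : Prop :=
  has_preperiod f k z /\ has_period f n (iter k (ratmap_eval f) z).

Definition mobius : set (ratmap C) := [set phi | degree phi = 1%N].

Definition quadratic : set (ratmap C) := [set f | degree f = 2%N].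

Definition conjugate f g : Prop :=
  exists2 phi, mobius phi &
    forall z, ratmap_eval phi (ratmap_eval f z)
              = ratmap_eval g (ratmap_eval phi z).

Definition moduli_class f : set (ratmap C) :=
  [set g | quadratic g /\ conjugate f g].

(* The moduli space, as a set of conjugacy classes. *)
Definition M2 : set (set (ratmap C)) := [set moduli_class f | f in quadratic].

Definition V (k n : nat) : set (set (ratmap C)) :=
  [set moduli_class f | f in
    [set f | quadratic f /\
             exists z, critical_point f z /\ preperiodic_to_cycle f k n z]].

Lemma V_sub_M2 k n : V k n `<=` M2.
Proof. by move=> c [f [qf _] <-]; exists f. Qed.

(* The point (sigma_1, sigma_2) of the affine plane. *)
Definition sigma12 f : 'I_2 -> C := fun i => sigma i.+1 f.

Definition zero_locus (S : set {mpoly C[2]}) : set ('I_2 -> C) :=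
  [set v | forall P, S P -> P.@[v] = 0].

(* The Zariski topology of the affine plane, carried over to the moduli space
   by the bijection [moduli_class f |-> sigma12 f]. *)
Definition zariski_closed (Z : set (set (ratmap C))) : Prop :=
  exists S : set {mpoly C[2]},
    Z = [set moduli_class f | f in
          [set f | quadratic f /\ zero_locus S (sigma12 f)]].

Definition relatively_closed (X A : set (set (ratmap C))) : Prop :=
  exists2 Z, zariski_closed Z & A = X `&` Z.

Definition irreducible (X : set (set (ratmap C))) : Prop :=
  X !=set0 /\
  ~ exists A B, [/\ relatively_closed X A, relatively_closed X B,
                    A <> X, B <> X & X = A `|` B].

End RationalMaps.

Arguments V C k n : clear implicits.

(* Main.v *)
Require Import Defs.
From mathcomp Require Import all_boot all_order all_algebra.
From mathcomp Require Import reals complex.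
From mathcomp Require Import boolp classical_sets mpoly ring.

(** The irreducibility of [V k 1] is that of one plane curve, which follows from
    an Eisenstein argument.

    Let a critical point of a quadratic map have preperiod [k = n + 1 >= 2] to a
    fixed point. The critical point, the fixed point and the last point of the
    orbit before the fixed point are distinct, so a Mobius change of coordinate
    sends them to [0], infinity and a finite nonzero point, and after scaling
    the map becomes [y |-> c + y^2 / (1 + t y)], whose pole is [-1/t]. The
    condition is then that the [n]-th iterate of [0] is [-1/t]. Writing that
    iterate as [A_n / B_n] with [A_n] and [B_n] polynomials in [t] and [c], it is
    [E_n = B_n + t A_n = 0] (lemmas [V_nf] and [nf_in_V]).

    The polynomial [E_n], seen in [C[t][c]], has constant coefficient [1], is
    congruent to [1] modulo [t], and its leading coefficient is divisible by [t]
    but not by [t^2]: modulo [t] the orbit is that of [y^2 + c], so that [A_n] is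
    monic of degree [2^(n-1)] in [c] modulo [t], while [B_n] has smaller degree.
    This is the Eisenstein criterion for the reversed polynomial, so [E_n] is
    irreducible over [C(t)]; as it vanishes on no line [t = constant], the curve
    [E_n = 0] is irreducible in the plane ([irreducible_plane_curve]).

    It remains to carry the Zariski topology over. The functions [sigma_1] and
    [sigma_2] of the normal form are polynomials in [t] and [c] ([sigma12_nf]),
    and they depend only on the conjugacy class ([sigma12_conj]). For the latter,
    multiplicities of fixed points need no tracking under conjugation: a multiple
    fixed point has multiplier [1], so the multipliers of the distinct fixed
    points, completed by ones up to three values, determine everything. Hence two
    proper closed subsets of [V k 1] pull back to proper closed subsets of the
    curve, and these do not cover it. *)

Set Implicit Arguments.
Unset Strict Implicit.
Unset Printing Implicit Defensive.

Import GRing.Theory.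
Local Open Scope ring_scope.

(** * Plane curves with an Eisenstein equation *)

Section PlaneCurves.
Variable C : closedFieldType.
Implicit Types (A B D E H M : {poly {poly C}}) (k e : {poly C}) (t c : C).

(** Elements of [{poly {poly C}}] are polynomials in [c] over [C[t]]; this is the
    restriction to the line of abscissa [t]. *)
Definition fiber t A : {poly C} := map_poly (horner_eval t) A.

Lemma fiber_horner t c A : (fiber t A).[c] = A.[c%:P].[t].
Proof. by rewrite -{1}[c](hornerC c t) -[_.[t]]/(horner_eval t _) horner_map. Qed.

Lemma coef_fiber t A i : (fiber t A)`_i = (A`_i).[t].
Proof. by rewrite coef_map. Qed.

Lemma fiberM t A B : fiber t (A * B) = fiber t A * fiber t B.
Proof. exact: rmorphM. Qed.

Lemma fiberZ t k A : fiber t (k *: A) = k.[t] *: fiber t A.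
Proof. by rewrite /fiber map_polyZ. Qed.

Lemma fiber_eq0 t A : fiber t A = 0 -> exists A', A = ('X - t%:P) *: A'.
Proof.
move=> A0; exists (\poly_(i < size A) (A`_i %/ ('X - t%:P))).
apply/polyP=> i; rewrite coefZ coef_poly; case: ltnP => [_|/leq_sizeP->//].
  by rewrite mulrC divpK // dvdp_XsubCl rootE -coef_fiber A0 coef0.
by rewrite mulr0.
Qed.

Lemma polyscaleI k : k != 0 -> injective (fun A => k *: A).
Proof.
move=> nzk A B; rewrite -!mul_polyC; apply: mulfI.
by rewrite polyC_eq0.
Qed.

(** Induction on the degree of [k]: if [k] vanishes at [t] then so does one of
    the two specialized factors, and ['X - t] can be cancelled. *)
Lemma strip_factor t k E D H :
    k != 0 -> fiber t E != 0 -> k *: E = D * H ->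
  exists k' D' H', [/\ k'.[t] != 0, k' *: E = D' * H',
                       size D' = size D & size H' = size H].
Proof.
have nzX : 'X - t%:P != 0 by rewrite polyXsubC_eq0.
elim/ltn_ind: {k}(size k) {-2}k (leqnn (size k)) D H => n IHn k le_kn D H nzk nzE eqE.
have [kt0|] := eqVneq k.[t] 0; last by exists k, D, H.
have [q Dk] : exists q, k = q * ('X - t%:P) by apply/factor_theorem/eqP.
have nzq : q != 0 by apply: contraNneq nzk => q0; rewrite Dk q0 mul0r.
have lt_qn : (size q < n)%N.
  by apply: leq_trans le_kn; rewrite Dk size_Mmonic ?monicXsubC // size_XsubC addn2.
have : fiber t D * fiber t H = 0 by rewrite -fiberM -eqE fiberZ kt0 scale0r.
move/eqP; rewrite mulf_eq0 => /orP[] /eqP/fiber_eq0[A' DA].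
  have eq' : q *: E = A' * H.
    apply: (polyscaleI nzX); by rewrite /= scalerA mulrC -Dk eqE DA scalerAl.
  have [k' [D' [H' [? ? sD ?]]]] := IHn _ lt_qn q (leqnn _) _ _ nzq nzE eq'.
  by exists k', D', H'; split; rewrite ?DA ?size_scale.
have eq' : q *: E = D * A'.
  apply: (polyscaleI nzX); by rewrite /= scalerA mulrC -Dk eqE DA scalerAr.
have [k' [D' [H' [? ? ? sH]]]] := IHn _ lt_qn q (leqnn _) _ _ nzq nzE eq'.
by exists k', D', H'; split; rewrite ?DA ?size_scale.
Qed.

(** Dividing by a nonzero [k] loses nothing on the curve [E = 0], even above
    the zeros of [k], since [E] vanishes on no line [t = constant]. *)
Lemma vanish_of_dvd k A E M t c :
    k != 0 -> fiber t E != 0 -> k *: A = E * M ->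
  E.[c%:P].[t] = 0 -> A.[c%:P].[t] = 0.
Proof.
move=> nzk nzE eqA Etc.
have nzX : 'X - t%:P != 0 by rewrite polyXsubC_eq0.
elim/ltn_ind: {k}(size k) {-2}k (leqnn (size k)) M nzk eqA => n IHn k le_kn M nzk eqA.
have [kt0|nzkt] := eqVneq k.[t] 0; last first.
  apply: (mulfI nzkt); rewrite mulr0 -hornerM -hornerZ eqA hornerM.
  by rewrite hornerM Etc mul0r.
have [q Dk] : exists q, k = q * ('X - t%:P) by apply/factor_theorem/eqP.
have nzq : q != 0 by apply: contraNneq nzk => q0; rewrite Dk q0 mul0r.
have lt_qn : (size q < n)%N.
  by apply: leq_trans le_kn; rewrite Dk size_Mmonic ?monicXsubC // size_XsubC addn2.
have : fiber t E * fiber t M = 0 by rewrite -fiberM -eqA fiberZ kt0 scale0r.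
move/eqP; rewrite mulf_eq0 (negPf nzE) => /eqP/fiber_eq0[M' DM].
apply: (IHn _ lt_qn q (leqnn _) M' nzq); apply: (polyscaleI nzX).
by rewrite /= scalerA mulrC -Dk eqA DM scalerAr.
Qed.

(** The Eisenstein criterion at the prime [t], read backwards: [E] is congruent
    to [1] modulo [t], so (once powers of [t] are cancelled) both factors are
    constant modulo [t]; if they had positive degree, [t] would divide both of
    their leading coefficients, and [t ^ 2] that of [E]. *)
Lemma reversed_eisenstein k E D H :
    k != 0 -> fiber 0 E = 1 -> ~~ ('X^2 %| lead_coef E) ->
    k *: E = D * H ->
  size D = 1 \/ size H = 1.
Proof.
move=> nzk E1 lcE eqE.
have nzE : fiber 0 E != 0 by rewrite E1 oner_eq0.
have [k' [D' [H' [nzk' eqE' <- <-]]]] := strip_factor nzk nzE eqE.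
have nzDH : D' * H' != 0.
  apply: contraNneq nzk' => DH0; have := congr1 (fiber 0) eqE'.
  rewrite DH0 fiberZ E1 /fiber rmorph0 => /(congr1 (fun p : {poly C} => p`_0)).
  by rewrite coefZ coef1 coef0 mulr1 => ->.
have [nzD nzH] : D' != 0 /\ H' != 0 by apply/norP; rewrite -mulf_eq0.
have : fiber 0 D' * fiber 0 H' = k'.[0]%:P.
  by rewrite -fiberM -eqE' fiberZ E1 alg_polyC.
move=> eqDH.
have lc F G : fiber 0 F * fiber 0 G = k'.[0]%:P -> F != 0 -> size F != 1 -> 'X %| lead_coef F.
  move=> eqFG nzF s1.
  (* The restriction of a factor to t = 0 divides a nonzero constant. *)
  have sF : size (fiber 0 F) = 1.
    apply/eqP; rewrite -dvdp1.
    have -> : (1 : {poly C}) = k'.[0]^-1 *: (fiber 0 F * fiber 0 G).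
      by rewrite eqFG -mul_polyC -polyCM mulVf.
    by rewrite dvdpZr ?invr_eq0 // dvdp_mulr.
  rewrite -['X]subr0 -polyC0 dvdp_XsubCl rootE -coef_fiber nth_default // sF.
  by move: s1 nzF; rewrite -size_poly_eq0; case: (size F) => [|[]].
case: (eqVneq (size D') 1) => [|sD]; first by left.
case: (eqVneq (size H') 1) => [|sH]; first by right.
case/negP: lcE.
have XD := lc _ _ eqDH nzD sD.
have XH : 'X %| lead_coef H' by apply: (lc _ (D') _ nzH sH); rewrite mulrC.
have : 'X^2 %| k' * lead_coef E.
  have -> : k' * lead_coef E = lead_coef D' * lead_coef H'.
    by rewrite -lead_coefM -eqE' -mul_polyC lead_coefM lead_coefC.
  by rewrite expr2 dvdp_mul.
rewrite Gauss_dvdpr // coprimep_expl // -['X]subr0 -polyC0.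
by rewrite coprimep_sym coprimep_XsubC rootE.
Qed.

(** With pseudo-division in [C[t][c]]: the gcd of [E] and [A] is either trivial,
    which gives a Bezout relation, or all of [E]. *)
Lemma vanish_or_bezout E A :
    fiber 0 E = 1 -> ~~ ('X^2 %| lead_coef E) ->
    (forall t, fiber t E != 0) ->
  (forall t c, E.[c%:P].[t] = 0 -> A.[c%:P].[t] = 0) \/
  exists U V e, e != 0 /\ U * E + V * A = e%:P.
Proof.
move=> E1 lcE nzE; set D := Pdiv.Idomain.gcdp E A.
have /Pdiv.Idomain.dvdpP[[k H] /= nzk DE] := Pdiv.Idomain.dvdp_gcdl E A.
have /Pdiv.Idomain.dvdpP[[l M] /= nzl DA] := Pdiv.Idomain.dvdp_gcdr E A.
rewrite -/D in DE DA.
have [sH|sD] := reversed_eisenstein nzk E1 lcE DE; last first.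
  right; have [[U V] /= /Pdiv.Idomain.eqpP[[a b] /andP[/= nza nzb]]] := Pdiv.Idomain.Bezoutp E A.
  have /eqP/size_poly1P[d nzd Dd] := sD.
  rewrite -/D Dd => eqUV; exists (a *: U), (a *: V), (b * d); split.
    by rewrite mulf_neq0.
  by rewrite -!scalerAl -scalerDr eqUV -mul_polyC polyCM.
left=> t c; have /eqP/size_poly1P[h nzh Dh] := sH.
have eqA : (h * l) *: A = E * (k *: M).
  by rewrite -scalerA DA -scalerAr [k *: (E * M)]scalerAl DE Dh mul_polyC -scalerAl [D * M]mulrC.
by apply: vanish_of_dvd eqA; rewrite ?mulf_neq0.
Qed.

(** The curve [E = 0] is irreducible: a product of Bezout relations bounds the
    common zeros with [A * B], while the curve has points over almost all [t]. *)
Lemma irreducible_plane_curve E A B :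
    (1 < size E)%N ->
    fiber 0 E = 1 -> ~~ ('X^2 %| lead_coef E) ->
    (forall t, fiber t E != 0) ->
    (exists t c, E.[c%:P].[t] = 0 /\ A.[c%:P].[t] != 0) ->
    (exists t c, E.[c%:P].[t] = 0 /\ B.[c%:P].[t] != 0) ->
  exists t c, [/\ E.[c%:P].[t] = 0, A.[c%:P].[t] != 0 & B.[c%:P].[t] != 0].
Proof.
move=> sE E1 lcE nzE [t1 [c1 [Etc1 Atc]]] [t2 [c2 [Etc2 Btc]]].
have [/(_ _ _ Etc1)/eqP|] := vanish_or_bezout A E1 lcE nzE.
  by rewrite (negPf Atc).
case=> [U1 [V1 [e1 [nze1 eq1]]]].
have [/(_ _ _ Etc2)/eqP|] := vanish_or_bezout B E1 lcE nzE.
  by rewrite (negPf Btc).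
case=> [U2 [V2 [e2 [nze2 eq2]]]].
have nzl : lead_coef E != 0 by rewrite lead_coef_eq0 -size_poly_gt0 ltnW.
have /closed_nonrootP[t] : e1 * e2 * lead_coef E != 0 by rewrite !mulf_neq0.
rewrite rootE !hornerM !mulf_eq0 !negb_or -andbA => /and3P[e1t e2t lt].
have /closed_rootP[c] : size (fiber t E) != 1.
  by rewrite size_map_poly_id0 ?neq_ltn ?sE ?orbT.
rewrite rootE fiber_horner => /eqP Etc; exists t, c; split=> //.
  apply: contraNneq e1t => Atc0.
  have := congr1 (fun F : {poly {poly C}} => F.[c%:P].[t]) eq1.
  by rewrite !hornerE Etc Atc0 !mulr0 addr0 => <-.
apply: contraNneq e2t => Btc0.
have := congr1 (fun F : {poly {poly C}} => F.[c%:P].[t]) eq2.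
by rewrite !hornerE Etc Btc0 !mulr0 addr0 => <-.
Qed.

End PlaneCurves.

(** * The orbit of the critical point as a polynomial in the parameters *)

Section CriticalOrbit.
Variable C : closedFieldType.
Implicit Types (t c : C) (n : nat).

(** The pair [(A_n, B_n)]: homogeneous coordinates of the [n]-th point of the
    orbit of [0] under [y |-> c + y^2 / (1 + t y)], the outer ['X] being [c] and
    the inner one [t]. *)
Fixpoint orbit_poly n : {poly {poly C}} * {poly {poly C}} :=
  if n is m.+1 then
    let: (A, B) := orbit_poly m in
    ('X * (B * (B + 'X *: A)) + A ^+ 2, B * (B + 'X *: A))
  else (0, 1).

(** The polynomial [E_n]; the denominator of the next point of the orbit is
    [B_n E_n], so the zeros of [E_n] send that point to infinity. *)
Definition curve_poly n : {poly {poly C}} :=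
  (orbit_poly n).2 + 'X *: (orbit_poly n).1.

Lemma orbit_polyS n : orbit_poly n.+1 =
  ('X * ((orbit_poly n).2 * curve_poly n) + (orbit_poly n).1 ^+ 2,
   (orbit_poly n).2 * curve_poly n).
Proof. by rewrite /curve_poly /=; case: orbit_poly. Qed.

Lemma orbit_poly_mod_t n :
  fiber 0 (orbit_poly n).2 = 1 /\ fiber 0 (curve_poly n) = 1.
Proof.
have E2 m : fiber 0 (orbit_poly m).2 = 1 -> fiber 0 (curve_poly m) = 1.
  move=> B1; rewrite /curve_poly /fiber rmorphD /= -!/(fiber _ _) B1.
  by rewrite fiberZ hornerX scale0r addr0.
elim: n => [|n [B1 E1]].
  by have B1 : fiber 0 (orbit_poly 0).2 = 1 by [exact: rmorph1]; split; last exact: E2.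
have B1' : fiber 0 (orbit_poly n.+1).2 = 1.
  by rewrite orbit_polyS /= fiberM B1 E1 mulr1.
by split; last exact: E2.
Qed.

Lemma orbit_poly_at0 n : (orbit_poly n).1.[0] = 0 /\ (orbit_poly n).2.[0] = 1.
Proof.
elim: n => [|n [A0 B1]]; first by rewrite !hornerE.
by rewrite orbit_polyS /curve_poly /= !hornerE A0 B1; split; ring.
Qed.

(** Modulo [t], the denominator is [1] and the numerator obeys the recursion
    [A |-> A^2 + c] of quadratic polynomials, hence is monic in [c]. *)
Lemma orbit_poly_top n :
  [/\ (size (orbit_poly n.+1).1 <= (2 ^ n).+1)%N,
      (size (orbit_poly n.+1).2 <= 2 ^ n)%N &
      ((orbit_poly n.+1).1`_(2 ^ n)).[0] = 1].
Proof.
elim: n => [|n [sA sB A1]].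
  rewrite /= scaler0 addr0 !mulr1 expr0n addr0 size_polyX size_poly1 expn0.
  by rewrite coefX /= hornerC.
have sE : (size (curve_poly n.+1) <= (2 ^ n).+1)%N.
  rewrite (leq_trans (size_polyD _ _)) // geq_max (leq_trans sB) //=.
  exact: leq_trans (size_scale_leq _ _) sA.
have sBE : (size ((orbit_poly n.+1).2 * curve_poly n.+1)%R <= 2 ^ n.+1)%N.
  rewrite (leq_trans (size_polyMleq _ _)) // expnS mul2n -addnn.
  by rewrite -subn1 leq_subLR add1n -addnS leq_add.
have pos : (0 < 2 ^ n)%N by rewrite expn_gt0.
rewrite orbit_polyS /=; split=> //.
  rewrite (leq_trans (size_polyD _ _)) // geq_max; apply/andP; split.
    by rewrite (leq_trans (size_polyMleq _ _)) // size_polyX add2n /= ltnS.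
  rewrite expr2 (leq_trans (size_polyMleq _ _)) // expnS mul2n -addnn.
  by rewrite -subn1 leq_subLR add1n -addnS -addSn leq_add.
rewrite coefD hornerD coefXM expn_eq0 /=.
have -> : ((orbit_poly n.+1).1 ^+ 2)`_(2 ^ n.+1) = ((orbit_poly n.+1).1`_(2 ^ n)) ^+ 2.
  rewrite !expr2 expnS mul2n -addnn coefM.
  have lt : (2 ^ n < (2 ^ n + 2 ^ n).+1)%N by rewrite ltnS leq_addl.
  rewrite (bigD1 (Ordinal lt)) //= big1 ?addr0 ?addnK // => i.
  rewrite -val_eqE /= neq_ltn => /orP[lti|lti].
    rewrite [X in _ * X]nth_default ?mulr0 // (leq_trans sA) //.
    by rewrite ltn_subRL ltn_add2r.
  by rewrite nth_default ?mul0r // (leq_trans sA).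
rewrite hornerE A1 -coef_fiber fiberM.
case: (orbit_poly_mod_t n.+1) => -> ->; rewrite mul1r coef1 -subn1 subn_eq0.
rewrite leqNgt (_ : 1 < 2 ^ n.+1)%N ?add0r ?mulr1 //.
  exact: expr1n.
by rewrite -[1%N](expn0 2) ltn_exp2l.
Qed.

(** For [c = 0] the critical point [0] is fixed, so [E_n] takes the value [1]. *)
Lemma curve_poly_fiber_neq0 n t : fiber t (curve_poly n) != 0.
Proof.
apply/eqP=> /(congr1 (fun p : {poly C} => p.[0])).
rewrite fiber_horner horner0 polyC0 /curve_poly hornerD hornerZ.
case: (orbit_poly_at0 n) => -> ->; rewrite mulr0 addr0 hornerC => /eqP.
by rewrite oner_eq0.
Qed.

(** The top coefficient comes from [t A_n] alone and is [t] times a polynomial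
    with value [1] at [t = 0]. *)
Lemma curve_poly_top n :
  size (curve_poly n.+1) = (2 ^ n).+1 /\
  ~~ ('X^2 %| lead_coef (curve_poly n.+1)).
Proof.
have [sA sB A1] := orbit_poly_top n.
have top : (curve_poly n.+1)`_(2 ^ n) = 'X * (orbit_poly n.+1).1`_(2 ^ n).
  by rewrite coefD coefZ nth_default // add0r.
have nzA : (orbit_poly n.+1).1`_(2 ^ n) != 0.
  by apply/eqP=> A0; move/eqP: A1; rewrite A0 hornerC eq_sym oner_eq0.
have sE : size (curve_poly n.+1) = (2 ^ n).+1.
  apply/eqP; rewrite eqn_leq (leq_trans (size_polyD _ _)) /=; last first.
    by rewrite geq_max (leq_trans sB) //= (leq_trans (size_scale_leq _ _)).
  rewrite ltnNge; apply/negP=> /leq_sizeP/(_ _ (leqnn _)) /eqP.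
  by rewrite top mulf_eq0 polyX_eq0 (negPf nzA).
split=> //; rewrite lead_coefE sE top expr2 dvdp_mul2l ?polyX_eq0 //.
by rewrite -['X]subr0 -polyC0 dvdp_XsubCl rootE A1 oner_eq0.
Qed.

End CriticalOrbit.

(** * Homogeneous coordinates and Mobius conjugacy *)

Section HomogeneousCoordinates.
Variable C : closedFieldType.
Implicit Types (f g h phi : ratmap C) (z : P1 C) (p q : {poly C}).

Definition pt (x y : C) : P1 C := if y == 0 then None else Some (x / y).

Lemma pt_scale k x y : k != 0 -> pt (k * x) (k * y) = pt x y.
Proof.
move=> nzk; rewrite /pt mulf_eq0 (negPf nzk) /=.
by case: eqP => // /eqP nzy; congr Some; rewrite -mulf_div divff // mul1r.
Qed.

Lemma pt_surj z : exists x y, ((x != 0) || (y != 0)) /\ z = pt x y.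
Proof.
case: z => [x|]; [exists x, 1 | exists 1, 0].
  by rewrite /pt oner_eq0 orbT divr1.
by rewrite /pt oner_eq0 eqxx.
Qed.

Lemma eq_pt x y x' y' : (x != 0) || (y != 0) -> (x' != 0) || (y' != 0) ->
  (pt x y = pt x' y') <-> (x * y' = x' * y).
Proof.
rewrite /pt; have [->|nzy] := eqVneq y 0; have [->|nzy'] := eqVneq y' 0.
- by rewrite !mulr0.
- rewrite orbF mulr0 => nzx _; split=> // /eqP.
  by rewrite mulf_eq0 (negPf nzx) (negPf nzy').
- rewrite orbF mulr0 => _ nzx; split=> // /esym/eqP.
  by rewrite mulf_eq0 (negPf nzx) (negPf nzy).
move=> _ _; split=> [[/eqP]|eqxy]; first by rewrite eqr_div // => /eqP.
by congr Some; apply/eqP; rewrite eqr_div //; apply/eqP.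
Qed.

Lemma pt_eqP x y x' y' : (x != 0) || (y != 0) -> (x' != 0) || (y' != 0) ->
  pt x y = pt x' y' -> exists2 k, k != 0 & x' = k * x /\ y' = k * y.
Proof.
move=> nzxy nzxy' /eq_pt-/(_ nzxy nzxy') eqxy.
have [y0|nzy] := eqVneq y 0.
  move: nzxy eqxy; rewrite y0 eqxx orbF mulr0 => nzx /eqP.
  rewrite mulf_eq0 (negPf nzx) /= => /eqP y'0; move: nzxy'; rewrite y'0 eqxx orbF.
  by move=> nzx'; exists (x' / x); rewrite ?mulf_neq0 ?invr_eq0 // divfK // mulr0.
have nzy' : y' != 0.
  apply: contraTneq nzxy' => y'0; move/eqP: eqxy.
  by rewrite y'0 mulr0 eq_sym mulf_eq0 (negPf nzy) orbF eqxx => ->.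
exists (y' / y); first by rewrite mulf_neq0 ?invr_eq0.
by rewrite divfK // mulrAC [y' * x]mulrC eqxy mulfK.
Qed.

(** The binary form of degree [d] whose restriction to [y = 1] is [p]; it treats
    the value at infinity on the same footing as the others. *)
Definition hform d p (x y : C) := \sum_(i < d.+1) p`_i * x ^+ i * y ^+ (d - i).

Lemma hform_horner d p x y : (size p <= d.+1)%N -> y != 0 ->
  hform d p x y = y ^+ d * p.[x / y].
Proof.
move=> sp nzy; rewrite (horner_coef_wide _ sp) mulr_sumr; apply: eq_bigr => i _.
have le_id : (i <= d)%N by rewrite -ltnS.
have -> : y ^+ d = y ^+ (d - i) * y ^+ i by rewrite -exprD subnK.
rewrite expr_div_n; field; exact: expf_neq0.
Qed.

Lemma hform_infty d p x : hform d p x 0 = p`_d * x ^+ d.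
Proof.
rewrite /hform big_ord_recr /= subnn mulr1 big1 ?add0r // => i _.
by rewrite expr0n subn_eq0 leqNgt ltn_ord mulr0.
Qed.

Lemma hform1 p x y : hform 1 p x y = p`_1 * x + p`_0 * y.
Proof. by rewrite /hform !big_ord_recr big_ord0 /=; ring. Qed.

Lemma hform2 p x y : hform 2 p x y = p`_2 * x ^+ 2 + p`_1 * x * y + p`_0 * y ^+ 2.
Proof. by rewrite /hform !big_ord_recr big_ord0 /= expr0 expr1; ring. Qed.

Lemma size_num_den f d : degree f = d ->
  (size (num f) <= d.+1)%N /\ (size (den f) <= d.+1)%N.
Proof.
by rewrite /degree => <-; split; rewrite (leq_trans _ (leqSpred _)) // leq_max leqnn ?orbT.
Qed.

Lemma ratmap_eval_pt f d x y : degree f = d -> (x != 0) || (y != 0) ->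
  ratmap_eval f (pt x y) = pt (hform d (num f) x y) (hform d (den f) x y).
Proof.
move=> fd; have [sn sd] := size_num_den fd.
have [->|nzy _] := eqVneq y 0.
  rewrite orbF {1}/pt eqxx !hform_infty => nzx.
  have -> : ratmap_eval f None = pt (num f)`_d (den f)`_d by rewrite -fd.
  by rewrite ![_ * x ^+ d]mulrC pt_scale ?expf_neq0.
have -> : pt x y = Some (x / y) by rewrite /pt (negPf nzy).
have -> : ratmap_eval f (Some (x / y)) = pt (num f).[x / y] (den f).[x / y] by [].
by rewrite !hform_horner // pt_scale ?expf_neq0.
Qed.

Lemma hform_neq0 f d x y : degree f = d -> (x != 0) || (y != 0) ->
  (hform d (num f) x y != 0) || (hform d (den f) x y != 0).
Proof.
move=> fd; have [sn sd] := size_num_den fd.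
have [->|nzy _] := eqVneq y 0; last first.
  rewrite !hform_horner // !mulf_eq0 !negb_or expf_neq0 //=.
  have := Pdiv.ClosedField.coprimepP _ _ (num_den_coprime f) (x / y).
  by rewrite rootE; case: eqP => // _ ->.
rewrite orbF !hform_infty => nzx; rewrite !mulf_eq0 !negb_or !expf_neq0 // !andbT.
have sgt : (0 < maxn (size (num f)) (size (den f)))%N.
  rewrite leq_max !size_poly_gt0 -negb_and; apply/andP=> -[/eqP n0 /eqP d0].
  by have := num_den_coprime f; rewrite n0 d0 coprime0p -size_poly_eq1 size_poly0.
have sE : maxn (size (num f)) (size (den f)) = d.+1 by rewrite -fd prednK.
move: sE sgt; rewrite /maxn; case: ltnP => _ sE sgt; apply/orP; [right|left].
  by rewrite -[d]/(d.+1.-1) -sE -lead_coefE lead_coef_eq0 -size_poly_gt0.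
by rewrite -[d]/(d.+1.-1) -sE -lead_coefE lead_coef_eq0 -size_poly_gt0.
Qed.

(** Pairs of binary forms of degree [d] without common zero are the same as
    rational maps of degree [d]. *)
Lemma mk_ratmap d p q : (size p <= d.+1)%N -> (size q <= d.+1)%N ->
    (forall x y, hform d p x y = 0 -> hform d q x y = 0 -> x = 0 /\ y = 0) ->
  {f : ratmap C | [/\ degree f = d, num f = p & den f = q]}.
Proof.
move=> sp sq nz.
have co : coprimep p q.
  apply/Pdiv.ClosedField.coprimepP=> x /rootP px; apply/eqP=> qx.
  have [] := nz x 1; rewrite ?hform_horner ?oner_neq0 // ?divr1 ?px ?qx ?mulr0 //.
  by move=> _ /eqP; rewrite oner_eq0.
exists (Ratmap co); split=> //; rewrite /degree /=.
have [pd0|npd] := eqVneq p`_d 0; last first.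
  have sp' : size p = d.+1.
    by apply/eqP; rewrite eqn_leq sp ltnNge; apply: contra npd => /leq_sizeP->.
  by rewrite sp' (maxn_idPl sq).
have [qd0|nqd] := eqVneq q`_d 0; last first.
  have sq' : size q = d.+1.
    by apply/eqP; rewrite eqn_leq sq ltnNge; apply: contra nqd => /leq_sizeP->.
  by rewrite sq' (maxn_idPr sp).
have [] := nz 1 0; rewrite ?hform_infty ?pd0 ?qd0 ?mul0r //.
by move/eqP; rewrite oner_eq0.
Qed.

Lemma linear_neq0 (p q r s x y : C) : p * s - q * r != 0 -> (x != 0) || (y != 0) ->
  (p * x + q * y != 0) || (r * x + s * y != 0).
Proof.
move=> nzd; apply: contraTT; rewrite !negb_or !negbK => /andP[/eqP eq1 /eqP eq2].
apply/andP; split; rewrite -(mulrI_eq0 _ (mulfI nzd)).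
  have -> : (p * s - q * r) * x = s * (p * x + q * y) - q * (r * x + s * y) by ring.
  by rewrite eq1 eq2 !mulr0 subr0.
have -> : (p * s - q * r) * y = p * (r * x + s * y) - r * (p * x + q * y) by ring.
by rewrite eq1 eq2 !mulr0 subr0.
Qed.

Lemma mk_mobius (p q r s : C) : p * s - q * r != 0 ->
  exists phi, mobius phi /\ forall x y, (x != 0) || (y != 0) ->
    ratmap_eval phi (pt x y) = pt (p * x + q * y) (r * x + s * y).
Proof.
move=> nzd.
have [] := @mk_ratmap 1 (Poly [:: q; p]) (Poly [:: s; r]).
- exact: leq_trans (size_Poly _) _.
- exact: leq_trans (size_Poly _) _.
- move=> x y; rewrite !hform1 !coef_Poly /= => eq1 eq2.
  have := contraNN (linear_neq0 (x := x) (y := y) nzd); rewrite !negb_or !negbK.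
  by rewrite eq1 eq2 eqxx => /(_ isT)/andP[/eqP-> /eqP->].
move=> phi [d1 n1 d2]; exists phi; split=> // x y nzxy.
by rewrite (ratmap_eval_pt d1) // !hform1 n1 d2 !coef_Poly.
Qed.

Lemma mobius_pt phi : mobius phi -> exists p q r s : C, p * s - q * r != 0 /\
  forall x y, (x != 0) || (y != 0) ->
    ratmap_eval phi (pt x y) = pt (p * x + q * y) (r * x + s * y).
Proof.
move=> d1; exists (num phi)`_1, (num phi)`_0, (den phi)`_1, (den phi)`_0.
split=> [|x y nzxy]; last by rewrite (ratmap_eval_pt d1) // !hform1.
apply/eqP=> det0.
have nz := @hform_neq0 phi 1 _ _ d1.
(* Were the determinant zero, (d0, -d1), then (n0, -n1), then anything would be a
   common zero of the two linear forms. *)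
have [e|] := boolP (((den phi)`_0 != 0) || (- (den phi)`_1 != 0)).
  have := nz _ _ e; rewrite !hform1.
  have -> : (num phi)`_1 * (den phi)`_0 + (num phi)`_0 * - (den phi)`_1 = 0.
    by rewrite mulrN det0.
  have -> : (den phi)`_1 * (den phi)`_0 + (den phi)`_0 * - (den phi)`_1 = 0 by ring.
  by rewrite eqxx.
rewrite oppr_eq0 negb_or !negbK => /andP[/eqP d0 /eqP d10].
have [e|] := boolP (((num phi)`_0 != 0) || (- (num phi)`_1 != 0)).
  have := nz _ _ e; rewrite !hform1 d0 d10.
  have -> : (num phi)`_1 * (num phi)`_0 + (num phi)`_0 * - (num phi)`_1 = 0 by ring.
  by rewrite !mul0r addr0 eqxx.
rewrite oppr_eq0 negb_or !negbK => /andP[/eqP n0 /eqP n10].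
have := nz 1 0; rewrite oner_eq0 => /(_ isT); rewrite !hform1 d0 d10 n0 n10.
by rewrite !mul0r addr0 eqxx.
Qed.

Lemma mobius_inv phi : mobius phi -> exists phi', [/\ mobius phi',
  cancel (ratmap_eval phi) (ratmap_eval phi') &
  cancel (ratmap_eval phi') (ratmap_eval phi)].
Proof.
case/mobius_pt=> p [q [r [s [nzd phiE]]]].
have nzd' : s * p - (- q) * (- r) != 0 by rewrite mulrNN mulrC.
have [phi' [mphi' phi'E]] := mk_mobius nzd'.
exists phi'; split=> // z; have [x [y [nzxy ->]]] := pt_surj z.
  rewrite phiE // phi'E ?linear_neq0 // -[RHS](pt_scale _ _ nzd).
  by congr pt; ring.
rewrite phi'E // phiE ?linear_neq0 // -[RHS](pt_scale _ _ nzd).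
by congr pt; ring.
Qed.

Lemma mobius_comp phi psi : mobius phi -> mobius psi ->
  exists2 chi, mobius chi & ratmap_eval chi =1 ratmap_eval phi \o ratmap_eval psi.
Proof.
case/mobius_pt=> p [q [r [s [nzd phiE]]]].
case/mobius_pt=> p' [q' [r' [s' [nzd' psiE]]]].
have nzd2 : (p * p' + q * r') * (r * q' + s * s') - (p * q' + q * s') * (r * p' + s * r') != 0.
  have -> : (p * p' + q * r') * (r * q' + s * s') - (p * q' + q * s') * (r * p' + s * r')
    = (p * s - q * r) * (p' * s' - q' * r') by ring.
  by rewrite mulf_neq0.
have [chi [mchi chiE]] := mk_mobius nzd2; exists chi => // z.
have [x [y [nzxy ->]]] := pt_surj z.
by rewrite chiE //= psiE // phiE ?linear_neq0 //; congr pt; ring.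
Qed.

Lemma conjugate_pointwise f g : (forall z, ratmap_eval f z = ratmap_eval g z) ->
  conjugate f g.
Proof.
move=> fg; have nz1 : 1 * 1 - 0 * 0 != 0 :> C by rewrite mulr1 mulr0 subr0 oner_eq0.
have [phi [mphi phiE]] := mk_mobius nz1.
have phi1 z : ratmap_eval phi z = z.
  by have [x [y [nzxy ->]]] := pt_surj z; rewrite phiE // !mul1r !mul0r addr0 add0r.
by exists phi => // z; rewrite !phi1 fg.
Qed.

Lemma conjugate_sym f g : conjugate f g -> conjugate g f.
Proof.
case=> phi /mobius_inv[phi' [mphi' phiK phi'K]] fg; exists phi' => // z.
by rewrite -{1}[z]phi'K -fg phiK.
Qed.

Lemma conjugate_trans f g h : conjugate f g -> conjugate g h -> conjugate f h.
Proof.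
case=> phi mphi fg [psi mpsi gh].
have [chi mchi chiE] := mobius_comp mpsi mphi.
by exists chi => // z; rewrite !chiE /= fg gh.
Qed.

Lemma moduli_classP f g : quadratic f -> quadratic g ->
  moduli_class f = moduli_class g <-> conjugate f g.
Proof.
move=> qf qg; split=> [fg|fg].
  have : moduli_class g g by split=> //; exact: conjugate_pointwise.
  by rewrite -fg => -[].
apply/seteqP; split=> h [qh ?]; split=> //.
  exact: conjugate_trans (conjugate_sym fg) _.
exact: conjugate_trans fg _.
Qed.

Lemma iter_conj phi f g n z :
  (forall z, ratmap_eval phi (ratmap_eval f z) = ratmap_eval g (ratmap_eval phi z)) ->
  ratmap_eval phi (iter n (ratmap_eval f) z) = iter n (ratmap_eval g) (ratmap_eval phi z).
Proof. by move=> fg; elim: n => //= n IHn; rewrite fg IHn. Qed.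

End HomogeneousCoordinates.

(** * Multipliers of quadratic maps under conjugacy *)

Section QuadraticMaps.
Variable C : closedFieldType.
Implicit Types (f g h phi : ratmap C) (z : P1 C) (P : {poly C}).

Lemma quadratic_size f : quadratic f ->
  (size (num f) <= 3)%N /\ (size (den f) <= 3)%N.
Proof. exact: size_num_den. Qed.

Lemma horner_size3 P x : (size P <= 3)%N -> P.[x] = P`_0 + P`_1 * x + P`_2 * x ^+ 2.
Proof. by move=> sP; rewrite (horner_coef_wide _ sP) !big_ord_recr big_ord0 /=; ring. Qed.

Lemma deriv_size3 P x : (size P <= 3)%N -> P^`().[x] = P`_1 + P`_2 * x *+ 2.
Proof.
move=> sP; have sP' : (size P^`() <= 2)%N.
  by rewrite (leq_trans (size_poly _ _)) // -subn1 leq_subLR.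
rewrite (horner_coef_wide _ sP') !big_ord_recr big_ord0 /= !coef_deriv; ring.
Qed.

(** Cross-multiplying gives a polynomial identity, as there are infinitely many
    points; coprimality then makes the two pairs proportional. *)
Lemma ratmap_ext f g : quadratic f -> ratmap_eval f =1 ratmap_eval g ->
  exists2 c, c != 0 & num g = c *: num f /\ den g = c *: den f.
Proof.
move=> qf fg.
have cross : num f * den g = num g * den f.
  apply/eqP; rewrite -subr_eq0; apply/negPn/negP=> /closed_nonrootP[x] /negP[].
  rewrite rootE !hornerE; have := fg (Some x); rewrite /ratmap_eval /=.
  have [->|d1] := eqVneq (den f).[x] 0; have [->|d2] := eqVneq (den g).[x] 0.
  - by rewrite !mulr0 subrr.
  - by [].
  - by [].
  by case=> /eqP; rewrite eqr_div // => /eqP ->; rewrite subrr.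
have nzn : num f != 0.
  apply/eqP=> n0; have := num_den_coprime f; rewrite n0 coprime0p -size_poly_eq1.
  by move=> /eqP s1; move: qf; rewrite /quadratic /= /degree n0 size_poly0 max0n s1.
have : num f %= num g.
  apply/andP; split.
    rewrite -(Gauss_dvdpl _ (num_den_coprime f)) -cross; exact: dvdp_mulr.
  rewrite -(Gauss_dvdpl _ (num_den_coprime g)) cross; exact: dvdp_mulr.
rewrite eqp_sym => /eqpf_eq[c nzc eqn]; exists c => //; split=> //.
by apply: (mulfI nzn); rewrite cross eqn -scalerAl scalerAr.
Qed.

Definition subst2 P (p q r s : C) : {poly C} :=
  Poly [:: P`_2 * q ^+ 2 + P`_1 * q * s + P`_0 * s ^+ 2;
           P`_2 * p * q *+ 2 + P`_1 * (p * s + q * r) + P`_0 * r * s *+ 2;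
           P`_2 * p ^+ 2 + P`_1 * p * r + P`_0 * r ^+ 2].

Lemma hform_subst2 P p q r s x y :
  hform 2 (subst2 P p q r s) x y = hform 2 P (p * x + q * y) (r * x + s * y).
Proof. by rewrite !hform2 !coef_Poly /=; ring. Qed.

Lemma hformD d (P Q : {poly C}) a b x y :
  hform d (a *: P + b *: Q) x y = a * hform d P x y + b * hform d Q x y.
Proof.
rewrite /hform !mulr_sumr -big_split; apply: eq_bigr => i _ /=.
by rewrite coefD !coefZ; ring.
Qed.

(** The lift of [phi^-1 o f o phi] is the lift of [f] composed on the right with
    the matrix of [phi] and on the left with its adjugate. *)
Lemma pullback f (p q r s : C) : quadratic f -> p * s - q * r != 0 ->
  exists h, [/\ quadratic h,
    num h = s *: subst2 (num f) p q r s + (- q) *: subst2 (den f) p q r s,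
    den h = p *: subst2 (den f) p q r s + (- r) *: subst2 (num f) p q r s &
    forall phi, (forall x y, (x != 0) || (y != 0) ->
        ratmap_eval phi (pt x y) = pt (p * x + q * y) (r * x + s * y)) ->
      forall z, ratmap_eval phi (ratmap_eval h z) = ratmap_eval f (ratmap_eval phi z)].
Proof.
move=> qf nzd.
have sz (P Q : {poly C}) (a b : C) :
    (size (a *: subst2 P p q r s + b *: subst2 Q p q r s)%R <= 3)%N.
  rewrite (leq_trans (size_polyD _ _)) // geq_max.
  by rewrite !(leq_trans (size_scale_leq _ _)) ?(leq_trans (size_Poly _)).
have := mk_ratmap (sz (num f) (den f) s (- q)) (sz (den f) (num f) p (- r)).
case=> [x y|h [qh nh dh]].
  rewrite !hformD !hform_subst2 => eq1 eq2.
  have [|] := boolP ((x != 0) || (y != 0)); last first.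
    by rewrite negb_or !negbK => /andP[/eqP-> /eqP->].
  move/(linear_neq0 nzd)/(hform_neq0 qf).
  set F := hform 2 (num f) _ _ in eq1 eq2 *; set G := hform 2 (den f) _ _ in eq1 eq2 *.
  have -> : F = 0.
    apply: (mulfI nzd); rewrite mulr0.
    have -> : (p * s - q * r) * F = p * (s * F + - q * G) + q * (p * G + - r * F) by ring.
    by rewrite eq1 eq2 !mulr0 addr0.
  have -> : G = 0.
    apply: (mulfI nzd); rewrite mulr0.
    have -> : (p * s - q * r) * G = r * (s * F + - q * G) + s * (p * G + - r * F) by ring.
    by rewrite eq1 eq2 !mulr0 addr0.
  by rewrite eqxx.
exists h; split=> // phi phiE z; have [x [y [nzxy ->]]] := pt_surj z.
rewrite (ratmap_eval_pt qh) // phiE ?(hform_neq0 qh) // phiE //.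
rewrite (ratmap_eval_pt qf) ?linear_neq0 // nh dh !hformD !hform_subst2.
by rewrite -[RHS](pt_scale _ _ nzd); congr pt; ring.
Qed.

(** The trace of the Jacobian matrix, at [(x, y)], of the lift of [f] by binary
    quadratic forms. *)
Definition trace2 f (x y : C) : C :=
  (num f)`_2 * x *+ 2 + (num f)`_1 * y + (den f)`_1 * x + (den f)`_0 * y *+ 2.

Lemma multiplier_infty f : quadratic f ->
  multiplier f None = ((den f)`_1 * (num f)`_2 - (den f)`_2 * (num f)`_1) / (num f)`_2 ^+ 2.
Proof.
move=> qf; rewrite /= /wronskian !hornerE !horner_coef0 !coef_deriv !mulr1n.
by rewrite /num_infty /den_infty qf !coef_poly.
Qed.

(** A homogeneous lift [(F, G)] of [f] sends a fixed direction [(x, y)] to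
    [mu * (x, y)]; by Euler's relation its Jacobian matrix there has eigenvalue
    [2 * mu] in that direction, and the other one is [mu] times the multiplier. *)
Lemma multiplier_trace f x y mu : quadratic f -> (x != 0) || (y != 0) ->
    hform 2 (num f) x y = mu * x -> hform 2 (den f) x y = mu * y ->
  multiplier f (pt x y) = trace2 f x y / mu - 2%:R.
Proof.
move=> qf nzxy Fx Gy; have [sn sd] := quadratic_size qf.
have nzmu : mu != 0.
  by have := hform_neq0 qf nzxy; apply: contraTneq => mu0; rewrite Fx Gy mu0 !mul0r eqxx.
have [y0|nzy] := eqVneq y 0.
  move: nzxy; rewrite y0 eqxx orbF => nzx.
  move: Fx Gy; rewrite y0 !hform_infty mulr0 => Fx /eqP.
  rewrite mulf_eq0 expf_eq0 /= (negPf nzx) orbF => /eqP d2.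
  have muE : mu = (num f)`_2 * x by apply: (mulIf nzx); rewrite -Fx; ring.
  move: nzmu; rewrite muE mulf_eq0 negb_or => /andP[nzn _].
  rewrite {1}/pt eqxx multiplier_infty // /trace2 d2; field.
  by rewrite nzn nzx.
have -> : pt x y = Some (x / y) by rewrite /pt (negPf nzy).
move: (Gy); rewrite hform2 => Gy'; move: Fx Gy; rewrite !hform_horner // => Fx Gy.
have dE : (den f).[x / y] = mu / y.
  by apply: (mulfI (expf_neq0 2 nzy)); rewrite Gy; field.
have nE : (num f).[x / y] = mu * x / y ^+ 2.
  by apply: (mulfI (expf_neq0 2 nzy)); rewrite Fx; field.
have d0E : (den f)`_0 = (mu * y - (den f)`_2 * x ^+ 2 - (den f)`_1 * x * y) / y ^+ 2.
  by rewrite -Gy'; field.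
rewrite /= /wronskian !hornerE dE nE !deriv_size3 // /trace2 d0E; field.
by rewrite nzmu nzy.
Qed.

(** Both the trace of the Jacobian and the scalar [mu] of [multiplier_trace] are
    invariant under a linear change of coordinates; the adjugate and the choice of
    a lift rescale them by the same factor. *)
Lemma multiplier_conj f g phi z : quadratic f -> quadratic g -> mobius phi ->
    (forall z, ratmap_eval phi (ratmap_eval f z) = ratmap_eval g (ratmap_eval phi z)) ->
    ratmap_eval f z = z ->
  multiplier g (ratmap_eval phi z) = multiplier f z.
Proof.
move=> qf qg mphi fg fz.
have [phi' [_ phiK _]] := mobius_inv mphi.
have [p [q [r [s [nzd phiE]]]]] := mobius_pt mphi.
have [h [qh nh dh /(_ phi phiE) hg]] := pullback qg nzd.
have hf : ratmap_eval h =1 ratmap_eval f.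
  by move=> w; apply: (can_inj phiK); rewrite hg fg.
have [c nzc [nf df]] := ratmap_ext qh hf.
have [x [y [nzxy Dz]]] := pt_surj z; rewrite {z}Dz in fz *.
have [k nzk [Fx Gy]] : exists2 k, k != 0 &
    hform 2 (num f) x y = k * x /\ hform 2 (den f) x y = k * y.
  by apply: pt_eqP; rewrite ?(hform_neq0 qf) // -(ratmap_eval_pt qf).
rewrite phiE //; set u := p * x + q * y; set v := r * x + s * y.
have nzcd : c * (p * s - q * r) != 0 by rewrite mulf_neq0.
have hZ P : hform 2 (c *: P) x y = c * hform 2 P x y by rewrite !hform2 !coefZ; ring.
have := Fx; have := Gy; rewrite nf df !hZ nh dh !hformD !hform_subst2 -/u -/v.
set F := hform 2 (num g) u v; set G := hform 2 (den g) u v => eq2 eq1.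
have eF : F = k / (c * (p * s - q * r)) * u.
  apply: (mulfI nzcd); transitivity (k * u); last by field; rewrite nzd nzc.
  have -> : k * u = p * (k * x) + q * (k * y) by rewrite /u; ring.
  by rewrite -eq1 -eq2; ring.
have eG : G = k / (c * (p * s - q * r)) * v.
  apply: (mulfI nzcd); transitivity (k * v); last by field; rewrite nzd nzc.
  have -> : k * v = r * (k * x) + s * (k * y) by rewrite /v; ring.
  by rewrite -eq1 -eq2; ring.
rewrite (multiplier_trace qg (linear_neq0 nzd nzxy) eF eG).
rewrite (multiplier_trace qf nzxy Fx Gy); congr (_ - _).
have -> : trace2 f x y = c * (p * s - q * r) * trace2 g u v.
  rewrite /trace2 nf df !coefZ nh dh !coefD !coefZ !coef_Poly /= /u /v; ring.
by field; rewrite nzk nzd nzc.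
Qed.

End QuadraticMaps.

(** * Conjugacy invariance of the symmetric functions of the multipliers *)

Section MultiplierSymmetricFunctions.
Variable C : closedFieldType.
Implicit Types (f g phi : ratmap C) (z : P1 C).

Definition multiplier_poly f : {poly C} :=
  \prod_(z <- fixed_points f) ('X - (multiplier f z)%:P).

Lemma sigma_multiplier_poly k f : (k <= size (fixed_points f))%N ->
  sigma k f = (-1) ^+ k * (multiplier_poly f)`_(size (fixed_points f) - k).
Proof.
move=> le_k; rewrite /multiplier_poly /sigma.
set s := fixed_points f in le_k *.
have lt_k : (k < (size s).+1)%N by [].
have := mroots_coeff (map_tuple (multiplier f) (in_tuple s)) (Ordinal lt_k).
rewrite /= big_map => ->; rewrite mulrA -expr2 sqrr_sign mul1r.
by congr meval; apply/funext=> i; rewrite tnth_map.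
Qed.

(** Grouping equal indices is harmless when repeated indices all contribute the
    same known factor: the multiplicities only enter through the length. *)
Lemma prod_undup (T : eqType) (R : comPzRingType) (s : seq T) (F : T -> R) (a : R) :
    (forall z : T, (1 < count_mem z s)%N -> F z = a) ->
  \prod_(z <- s) F z = (\prod_(z <- undup s) F z) * a ^+ (size s - size (undup s)).
Proof.
elim: s => [|z s IHs] Fa; first by rewrite !big_nil mulr1.
have Fs w : (1 < count_mem w s)%N -> F w = a.
  by move=> lt; apply: Fa; rewrite (leq_trans lt) // leq_addl.
rewrite big_cons (IHs Fs) /=; case: ifP => [zs|_]; last by rewrite big_cons mulrA.
rewrite (Fa z) ?subSn ?size_undup //; last by rewrite /= eqxx add1n ltnS -has_count has_pred1.
by rewrite exprS mulrCA.
Qed.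

Section FixedPoints.
Variables (f : ratmap C) (qf : quadratic f).

Let F := num f - 'X * den f.
Let r := sval (closed_field_poly_normal F).

Let F_roots : F = lead_coef F *: \prod_(z <- r) ('X - z%:P).
Proof. exact: (svalP (closed_field_poly_normal F)). Qed.

Let size_num3 : (size (num f) <= 3)%N. Proof. by case: (quadratic_size qf). Qed.
Let size_den3 : (size (den f) <= 3)%N. Proof. by case: (quadratic_size qf). Qed.

Let F_coef i : F`_i.+1 = (num f)`_i.+1 - (den f)`_i.
Proof. by rewrite coefB coefXM. Qed.

Let size_F : (size F <= 4)%N.
Proof.
apply/leq_sizeP=> -[//|j] lt3j.
rewrite F_coef (leq_sizeP _ _ size_num3) ?(leq_sizeP _ _ size_den3) ?subr0 //.
exact: ltnW.
Qed.

Let F_neq0 : F != 0.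
Proof.
apply/eqP=> F0; have nE : num f = 'X * den f by apply/eqP; rewrite -subr_eq0 -/F F0.
have := num_den_coprime f; rewrite nE coprimepMl => /andP[_].
rewrite coprimepp => /eqP s1; move: qf; rewrite /quadratic /= /degree nE.
by rewrite mulrC size_mulX -?size_poly_gt0 s1.
Qed.

Let size_r : (size r).+1 = size F.
Proof. by rewrite [in RHS]F_roots size_scale ?lead_coef_eq0 // size_prod_XsubC. Qed.

Let fixed_pointsE : fixed_points f = map Some r ++ nseq (3 - size r) None.
Proof. by rewrite /fixed_points qf -/F -/r -size_r. Qed.

Let count_Some x : count_mem (Some x) (fixed_points f) = count_mem x r.
Proof.
rewrite fixed_pointsE count_cat count_map count_nseq mul0n addn0.
by apply: eq_count => w /=.
Qed.

Let count_None : count_mem None (fixed_points f) = (3 - size r)%N.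
Proof.
rewrite fixed_pointsE count_cat count_map count_nseq mul1n.
by rewrite (eq_count (a2 := pred0)) ?count_pred0.
Qed.

Lemma size_fixed_points : size (fixed_points f) = 3.
Proof.
by rewrite fixed_pointsE size_cat size_map size_nseq subnKC // -ltnS size_r.
Qed.

Lemma mem_fixed_points z : (z \in fixed_points f) = (ratmap_eval f z == z).
Proof.
rewrite -has_pred1 has_count; case: z => [x|].
  rewrite count_Some -has_count has_pred1.
  have -> : (x \in r) = root F x.
    by rewrite F_roots rootZ ?lead_coef_eq0 // root_prod_XsubC.
  rewrite /ratmap_eval /= rootE /F !hornerE.
  have [d0|nd] := eqVneq (den f).[x] 0.
    rewrite d0 mulr0 subr0; apply/negbTE.
    have := Pdiv.ClosedField.coprimepP _ _ (num_den_coprime f) x.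
    by rewrite rootE d0 eqxx; case: eqP => // _ /(_ isT).
  by rewrite subr_eq0 (inj_eq Some_inj) -[RHS](inj_eq (mulIf nd)) divfK.
rewrite count_None subn_gt0 /ratmap_eval qf /=.
have -> : (size r < 3)%N = ((den f)`_2 == 0).
  have <- : - F`_3 = (den f)`_2 by rewrite F_coef nth_default // sub0r opprK.
  rewrite -ltnS size_r oppr_eq0.
  apply/idP/idP=> [/leq_sizeP-> //|F3].
  apply/leq_sizeP=> j; rewrite leq_eqVlt => /predU1P[<-|]; first exact/eqP.
  exact: (leq_sizeP _ _ size_F).
by case: ifP.
Qed.

(** Where the fixed-point equation has a multiple root, its derivative, which
    is the multiplier minus one up to a nonzero factor, vanishes. *)
Lemma multiple_fixed_point z :
  (1 < count_mem z (fixed_points f))%N -> multiplier f z = 1.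
Proof.
case: z => [x|].
  rewrite count_Some => lt1.
  have xr : x \in r by rewrite -has_pred1 has_count ltnW.
  have [r' Fr'] : exists P, F = ('X - x%:P) ^+ 2 * P.
    have xr' : x \in rem x r.
      by rewrite -has_pred1 has_count count_rem /= eqxx xr subn_gt0.
    exists (lead_coef F *: \prod_(z <- rem x (rem x r)) ('X - z%:P)).
    rewrite [LHS]F_roots (perm_big _ (perm_to_rem xr)) big_cons.
    by rewrite (perm_big _ (perm_to_rem xr')) big_cons -scalerAr expr2 -mulrA.
  have F0 : F.[x] = 0 by rewrite Fr' !hornerE subrr expr0n mul0r.
  have F'0 : F^`().[x] = 0.
    by rewrite Fr' derivM expr2 derivM !hornerE subrr !(mul0r, mulr0, addr0).
  have nE : (num f).[x] = x * (den f).[x].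
    by apply/eqP; rewrite -subr_eq0 -F0 /F !hornerE.
  have n'E : (num f)^`().[x] = (den f).[x] + x * (den f)^`().[x].
    by apply/eqP; rewrite -subr_eq0 -F'0 /F derivB derivM derivX !hornerE.
  have nd : (den f).[x] != 0.
    apply/eqP=> d0; have := Pdiv.ClosedField.coprimepP _ _ (num_den_coprime f) x.
    by rewrite rootE nE d0 mulr0 eqxx => /(_ isT).
  by rewrite /= /wronskian !hornerE nE n'E; field.
rewrite count_None => lt1.
have sF : (size F <= 2)%N by rewrite -size_r; move: lt1; case: (size r) => [|[|[|]]].
have : F`_3 = 0 by rewrite nth_default // (leq_trans sF).
rewrite F_coef nth_default // sub0r => /eqP; rewrite oppr_eq0 => /eqP d2.
have : F`_2 = 0 by rewrite nth_default.
rewrite F_coef => /eqP; rewrite subr_eq0 => /eqP n2.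
rewrite multiplier_infty // d2 -n2; field.
have := @hform_neq0 C f 2 1 0 qf; rewrite oner_eq0 => /(_ isT).
by rewrite !hform_infty d2 !expr1n mul0r eqxx orbF mulr1.
Qed.

Lemma multiplier_poly_undup : multiplier_poly f =
  (\prod_(z <- undup (fixed_points f)) ('X - (multiplier f z)%:P))
  * ('X - 1) ^+ (3 - size (undup (fixed_points f))).
Proof.
rewrite /multiplier_poly (prod_undup (a := 'X - 1)) ?size_fixed_points // => z.
by move=> /multiple_fixed_point->.
Qed.

Lemma fixed_points_roots : exists r : seq C,
  [/\ num f - 'X * den f =
        lead_coef (num f - 'X * den f) *: \prod_(z <- r) ('X - z%:P),
      lead_coef (num f - 'X * den f) != 0, (size r <= 3)%N &
      fixed_points f = map Some r ++ nseq (3 - size r) None].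
Proof. by exists r; split; rewrite ?lead_coef_eq0 // -ltnS size_r. Qed.

End FixedPoints.

Lemma sigma_of_multipliers f a b c : quadratic f ->
    map (multiplier f) (fixed_points f) = [:: a; b; c] ->
  sigma 1 f = a + b + c /\ sigma 2 f = a * b + a * c + b * c.
Proof.
move=> qf mf; rewrite !sigma_multiplier_poly ?size_fixed_points //=.
have -> : multiplier_poly f = Poly [:: - (a * b * c); a * b + a * c + b * c; - (a + b + c); 1].
  rewrite /multiplier_poly -(big_map _ predT (fun l => 'X - l%:P)) mf.
  rewrite !big_cons big_nil /= !cons_poly_def !(polyCN, polyCD, polyCM); ring.
by rewrite !coef_Poly /=; split; ring.
Qed.

Lemma multiplier_poly_conj f g : quadratic f -> quadratic g -> conjugate f g ->
  multiplier_poly f = multiplier_poly g.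
Proof.
move=> qf qg [phi mphi fg]; have [phi' [_ phiK phi'K]] := mobius_inv mphi.
have pm : perm_eq (undup (fixed_points g))
                  (map (ratmap_eval phi) (undup (fixed_points f))).
  apply: uniq_perm; rewrite ?map_inj_uniq ?undup_uniq //; first exact: can_inj phiK.
  move=> z; rewrite mem_undup mem_fixed_points // -{1 2 3}[z]phi'K.
  rewrite (mem_map (can_inj phiK)) mem_undup mem_fixed_points // -fg.
  by rewrite (inj_eq (can_inj phiK)).
rewrite !multiplier_poly_undup // (perm_big _ pm) (perm_size pm) size_map big_map.
congr (_ * _); rewrite !big_seq; apply: eq_bigr => z.
rewrite mem_undup mem_fixed_points // => /eqP fz.
by rewrite (multiplier_conj qf qg mphi fg fz).
Qed.

Lemma sigma_conj f g k : quadratic f -> quadratic g -> conjugate f g ->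
  (k <= 3)%N -> sigma k f = sigma k g.
Proof.
move=> qf qg fg le_k.
rewrite !sigma_multiplier_poly ?size_fixed_points //.
by rewrite (multiplier_poly_conj qf qg fg).
Qed.

Lemma sigma12_conj f g : quadratic f -> quadratic g -> conjugate f g ->
  sigma12 f = sigma12 g.
Proof.
move=> qf qg fg; apply/funext=> i; apply: sigma_conj => //.
exact: leq_trans (ltn_ord i) _.
Qed.

End MultiplierSymmetricFunctions.

(** * Critical points and fibres *)

Section CriticalFibre.
Variable C : closedFieldType.
Implicit Types (f : ratmap C) (z : P1 C).

(** A constant map is not quadratic. *)
Lemma proportional_not_quadratic f (a b : C) : quadratic f -> (a != 0) || (b != 0) ->
  b *: num f <> a *: den f.
Proof.
move=> qf nzab eqf.
have small (P Q : {poly C}) (k l : C) : coprimep P Q -> k != 0 -> k *: P = l *: Q ->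
    (maxn (size P) (size Q) <= 1)%N.
  move=> co nzk eqPQ; have PE : P = (l / k) *: Q.
    by rewrite mulrC -scalerA -eqPQ scalerA mulVf // scale1r.
  have sQ : size Q = 1.
    apply/eqP; rewrite -dvdp1 -(eqp_dvdr _ (_ : gcdp P Q %= 1)) ?gcdp_eqp1 //.
    by rewrite dvdp_gcd dvdpp andbT PE -mul_polyC dvdp_mull.
  by rewrite geq_max sQ leqnn andbT PE (leq_trans (size_scale_leq _ _)) ?sQ.
suff : (degree f <= 0)%N by rewrite qf.
rewrite /degree -subn1 leq_subLR addn0.
have [a0|nza] := eqVneq a 0; last first.
  rewrite maxnC; apply: small nza (esym eqf).
  by rewrite coprimep_sym num_den_coprime.
by move: nzab; rewrite a0 eqxx /= => nzb; apply: small nzb eqf; apply: num_den_coprime.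
Qed.

(** The form [b F - a G] whose zeros are the fibre of [f] over [a : b] has a
    double zero at a critical point over [a : b], hence no other zero. *)
Lemma critical_fiber f z w : quadratic f -> critical_point f z ->
  ratmap_eval f w = ratmap_eval f z -> w = z.
Proof.
move=> qf; have [sn sd] := quadratic_size qf.
have [u [v [nzuv ->]]] := pt_surj w.
have hP (P : {poly C}) x : (size P <= 3)%N -> P.[x] = hform 2 P x 1.
  by move=> sP; rewrite hform_horner ?oner_neq0 // expr1n mul1r divr1.
have lift x y : (x != 0) || (y != 0) -> ratmap_eval f (pt u v) = ratmap_eval f (pt x y) ->
    hform 2 (den f) x y * hform 2 (num f) u v = hform 2 (num f) x y * hform 2 (den f) u v.
  move=> nzxy; rewrite !(ratmap_eval_pt qf) // => /pt_eqP[||k nzk [-> ->]]; last by ring.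
    exact: hform_neq0 qf _ .
  exact: hform_neq0 qf _.
case: z => [x|] /=.
  rewrite rootE /wronskian !hornerE !deriv_size3 // !hP // => crit.
  have -> : Some x = pt x 1 by rewrite /pt oner_eq0 divr1.
  have nzx : (x != 0) || (1 != 0 :> C) by rewrite oner_eq0 orbT.
  move/(lift _ _ nzx); have nzab := hform_neq0 qf nzx.
  set a := hform 2 (num f) x 1 in crit nzab *.
  set b := hform 2 (den f) x 1 in crit nzab *.
  move=> eqw; apply/eq_pt => //; rewrite mulr1.
  have q1 : b * (num f)`_1 - a * (den f)`_1 = - (b * (num f)`_2 - a * (den f)`_2) * x *+ 2.
    by apply: subr0_eq; rewrite -[RHS](eqP crit); ring.
  have q0 : b * (num f)`_0 - a * (den f)`_0 = (b * (num f)`_2 - a * (den f)`_2) * x ^+ 2.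
    have aE : a = (num f)`_2 * x ^+ 2 + (num f)`_1 * x + (num f)`_0.
      by rewrite /a hform2; ring.
    have bE : b = (den f)`_2 * x ^+ 2 + (den f)`_1 * x + (den f)`_0.
      by rewrite /b hform2; ring.
    transitivity (b * a - a * b
       - (b * (num f)`_2 - a * (den f)`_2) * x ^+ 2
       - (b * (num f)`_1 - a * (den f)`_1) * x); last by rewrite q1; ring.
    by rewrite {2}aE {3}bE; ring.
  have : (b * (num f)`_2 - a * (den f)`_2) * (u - x * v) ^+ 2 = 0.
    move/eqP: eqw; rewrite -subr_eq0 => /eqP; rewrite !hform2 => eqw.
    transitivity ((b * (num f)`_2 - a * (den f)`_2) * u ^+ 2
       + (- (b * (num f)`_2 - a * (den f)`_2) * x *+ 2) * u * v
       + ((b * (num f)`_2 - a * (den f)`_2) * x ^+ 2) * v ^+ 2); first by ring.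
    by rewrite -q1 -q0 -[RHS]eqw; ring.
  move/eqP; rewrite mulf_eq0 expf_eq0 /= => /orP[/eqP q2|]; last by rewrite subr_eq0 => /eqP.
  case: (proportional_not_quadratic qf nzab).
  apply/polyP=> -[|[|[|i]]]; rewrite !coefZ; apply/eqP; rewrite -subr_eq0.
  - by rewrite q0 q2 mul0r.
  - by rewrite q1 q2 oppr0 mul0r mul0rn eqxx.
  - by rewrite q2 eqxx.
  by rewrite (leq_sizeP _ _ sn i.+3) ?(leq_sizeP _ _ sd i.+3) ?mulr0 ?subrr.
rewrite rootE /wronskian !hornerE !horner_coef0 !coef_deriv !mulr1n.
rewrite /num_infty /den_infty qf !coef_poly /= => crit.
have -> : None = pt 1 0 :> P1 C by rewrite /pt eqxx.
have nz1 : (1 != 0 :> C) || (0 != 0 :> C) by rewrite oner_eq0.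
move/(lift _ _ nz1); have nzab := hform_neq0 qf nz1.
move: nzab; rewrite !hform_infty !expr1n !mulr1 => nzab.
move=> eqw; apply/eq_pt => //; rewrite mulr0 mul1r.
have q1 : (den f)`_2 * (num f)`_1 - (num f)`_2 * (den f)`_1 = 0.
  by rewrite -[RHS](eqP crit); ring.
have : ((den f)`_2 * (num f)`_0 - (num f)`_2 * (den f)`_0) * v ^+ 2 = 0.
  transitivity ((den f)`_2 * hform 2 (num f) u v - (num f)`_2 * hform 2 (den f) u v
    - ((den f)`_2 * (num f)`_1 - (num f)`_2 * (den f)`_1) * u * v).
    by rewrite !hform2; ring.
  by rewrite eqw q1 subrr !mul0r subrr.
move/eqP; rewrite mulf_eq0 expf_eq0 /= => /orP[/eqP q0|/eqP-> //].
case: (proportional_not_quadratic qf nzab).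
apply/polyP=> -[|[|[|i]]]; rewrite !coefZ; apply/eqP; rewrite -subr_eq0.
- by rewrite q0 eqxx.
- by rewrite q1 eqxx.
- by rewrite mulrC subrr.
by rewrite (leq_sizeP _ _ sn i.+3) ?(leq_sizeP _ _ sd i.+3) ?mulr0 ?subrr.
Qed.

End CriticalFibre.

(** * The normal form *)

Section NormalForm.
Variable C : closedFieldType.
Implicit Types (f g h phi : ratmap C) (z : P1 C) (t c : C) (n : nat).

Definition nf_num t c : {poly C} := Poly [:: c; c * t; 1].
Definition nf_den t : {poly C} := Poly [:: 1; t].

Lemma hform_nf_num t c x y :
  hform 2 (nf_num t c) x y = x ^+ 2 + c * (y * (y + t * x)).
Proof. by rewrite hform2 !coef_Poly /=; ring. Qed.

Lemma hform_nf_den t x y : hform 2 (nf_den t) x y = y * (y + t * x).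
Proof. by rewrite hform2 !coef_Poly /=; ring. Qed.

Lemma nf_exists t c :
  {f : ratmap C | [/\ degree f = 2%N, num f = nf_num t c & den f = nf_den t]}.
Proof.
apply: mk_ratmap => [||x y]; rewrite ?(leq_trans (size_Poly _)) //.
rewrite hform_nf_num hform_nf_den => eqF eqG; move: eqF.
rewrite eqG mulr0 addr0 => /eqP; rewrite expf_eq0 /= => /eqP x0; split=> //.
by move/eqP: eqG; rewrite x0 mulr0 addr0 mulf_eq0 orbb => /eqP.
Qed.

(** The map [y |-> c + y^2 / (1 + t y)]. *)
Definition normal_form t c : ratmap C := sval (nf_exists t c).

Lemma quadratic_nf t c : quadratic (normal_form t c).
Proof. by rewrite /normal_form; case: nf_exists => f []. Qed.

Lemma num_nf t c : num (normal_form t c) = nf_num t c.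
Proof. by rewrite /normal_form; case: nf_exists => f []. Qed.

Lemma den_nf t c : den (normal_form t c) = nf_den t.
Proof. by rewrite /normal_form; case: nf_exists => f []. Qed.

Lemma nf_pt t c x y : (x != 0) || (y != 0) ->
  ratmap_eval (normal_form t c) (pt x y) =
    pt (x ^+ 2 + c * (y * (y + t * x))) (y * (y + t * x)).
Proof.
move=> nzxy; rewrite (ratmap_eval_pt (quadratic_nf t c)) //.
by rewrite num_nf den_nf hform_nf_num hform_nf_den.
Qed.

Lemma nf_neq0 t c x y : (x != 0) || (y != 0) ->
  (x ^+ 2 + c * (y * (y + t * x)) != 0) || (y * (y + t * x) != 0).
Proof.
move=> nzxy; have := hform_neq0 (quadratic_nf t c) nzxy.
by rewrite num_nf den_nf hform_nf_num hform_nf_den.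
Qed.

Lemma nf_critical t c : critical_point (normal_form t c) (Some 0).
Proof.
rewrite /= rootE /wronskian num_nf den_nf !hornerE !horner_coef0 !coef_deriv.
by rewrite !coef_Poly /= !mulr1n; apply/eqP; ring.
Qed.

Lemma nf_infty t c : ratmap_eval (normal_form t c) None = None.
Proof. by rewrite /ratmap_eval quadratic_nf den_nf /= coef_Poly /= eqxx. Qed.

Lemma nf_orbit t c n :
  let A := (orbit_poly C n).1.[c%:P].[t] in
  let B := (orbit_poly C n).2.[c%:P].[t] in
  ((A != 0) || (B != 0)) /\ iter n (ratmap_eval (normal_form t c)) (Some 0) = pt A B.
Proof.
elim: n => [|n [nz IHn]].
  by rewrite /= !hornerE oner_eq0 orbT /pt oner_eq0 mul0r.
rewrite iterS IHn nf_pt // orbit_polyS /curve_poly /=.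
rewrite !(hornerD, hornerM, hornerZ, hornerX, hornerC, horner_exp) addrC.
by split=> //; exact: nf_neq0.
Qed.

(** In the orbit of the critical point [0] of the normal form, [E_n] vanishes
    exactly when the [n]-th point is [-1/t], the other preimage of infinity. *)
Lemma nf_in_V t c n : (curve_poly C n).[c%:P].[t] = 0 ->
  V C n.+1 1 (moduli_class (normal_form t c)).
Proof.
move=> Etc; have [nzAB itn] := nf_orbit t c n.
set A := (orbit_poly C n).1.[c%:P].[t] in nzAB itn.
set B := (orbit_poly C n).2.[c%:P].[t] in nzAB itn.
have EAB : B + t * A = 0 by rewrite -Etc /curve_poly !hornerE.
have nzB : B != 0.
  apply/eqP=> B0; move: EAB nzAB; rewrite B0 add0r eqxx orbF => /eqP.
  rewrite mulf_eq0 => /orP[/eqP t0|->] // _.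
  have := (orbit_poly_mod_t C n).2 => /(congr1 (fun P => P.[c])).
  by rewrite fiber_horner -t0 Etc hornerC => /esym/eqP; rewrite oner_eq0.
set f := normal_form t c.
have itS : iter n.+1 (ratmap_eval f) (Some 0) = None.
  by rewrite iterS itn nf_pt // EAB mulr0 /pt eqxx.
have per : has_period f 1 None by split=> // [|[|[|m]]] //; exact: nf_infty.
have itinf m : iter m (ratmap_eval f) None = None.
  by elim: m => //= m ->; exact: nf_infty.
exists f => //; split; first exact: quadratic_nf.
exists (Some 0); split; first exact: nf_critical.
split; last by rewrite itS.
split=> [|j lt_jn [m [m_gt0 itm _]]]; first by rewrite itS; exists 1%N.
(* A periodic point of the orbit would lie in the forward orbit of infinity. *)
set w := iter j _ _ in itm.
have itl l : iter (l * m) (ratmap_eval f) w = w.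
  by elim: l => // l IHl; rewrite mulSn iterD IHl.
have w_inf : w = None.
  rewrite -(itl n.+1) /w -iterD.
  have le : (n.+1 <= n.+1 * m + j)%N by rewrite (leq_trans (leq_pmulr _ m_gt0)) // leq_addr.
  by rewrite -(subnK le) iterD itS itinf.
have : iter n (ratmap_eval f) (Some 0) = None.
  have le : (j <= n)%N by [].
  by rewrite -(subnK le) iterD -/w w_inf itinf.
by rewrite itn /pt (negPf nzB).
Qed.

(** Sending the fixed point to infinity, the critical point to [0] and the last
    point before the fixed point to [-1], the map becomes
    [(n2 X^2 + n0 X + n0) / (d0 X + d0)]; the scaling by [n2 / d0] makes it a
    normal form. *)
Lemma V_nf n X : (0 < n)%N -> V C n.+1 1 X ->
  exists t c, (curve_poly C n).[c%:P].[t] = 0 /\ X = moduli_class (normal_form t c).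
Proof.
move=> n_gt0 [f [qf [z [crit [[_ nper] [_ fixb _]]]]] <-] {X}.
set b := iter n.+1 (ratmap_eval f) z in fixb; rewrite /= in fixb.
set y := iter n (ratmap_eval f) z.
have fy : ratmap_eval f y = b by rewrite /b iterS.
have perb : periodic f b by exists 1%N; split=> // -[|[|m]].
have yb : y <> b by move=> yb; apply: (nper n) => //; rewrite -/y yb.
have zb : z <> b by move=> zb; apply: (nper 0%N) => //=; rewrite zb.
have yz : y <> z.
  move=> yz; apply/zb/esym; apply: (critical_fiber qf crit).
  by rewrite fixb -fy yz.
have [b1 [b2 [nzb Db]]] := pt_surj b.
have [z1 [z2 [nzz Dz]]] := pt_surj z.
have [y1 [y2 [nzy Dy]]] := pt_surj y.
have yzd : y1 * z2 - y2 * z1 != 0.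
  by rewrite subr_eq0; apply/eqP=> e; apply: yz; rewrite Dy Dz; apply/eq_pt; rewrite // e mulrC.
have byd : b1 * y2 - b2 * y1 != 0.
  by rewrite subr_eq0; apply/eqP=> e; apply/yb/esym; rewrite Dy Db; apply/eq_pt; rewrite // e mulrC.
have bzd : b1 * z2 - b2 * z1 != 0.
  by rewrite subr_eq0; apply/eqP=> e; apply/zb/esym; rewrite Dz Db; apply/eq_pt; rewrite // e mulrC.
(* With these scalings phi maps (-1 : 1) to the point y. *)
pose k1 := - (y1 * z2 - y2 * z1); pose k2 := b1 * y2 - b2 * y1.
have nzd : (k1 * b1) * (k2 * z2) - (k2 * z1) * (k1 * b2) != 0.
  have -> : (k1 * b1) * (k2 * z2) - (k2 * z1) * (k1 * b2) = k1 * k2 * (b1 * z2 - b2 * z1) by ring.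
  by rewrite !mulf_neq0 // oppr_eq0.
have [phi [mphi phiE]] := mk_mobius nzd.
have [phi' [_ phiK _]] := mobius_inv mphi; have phiI := can_inj phiK.
have [h [qh _ _ /(_ phi phiE) hf]] := pullback qf nzd.
have nz10 : (1 != 0 :> C) || (0 != 0 :> C) by rewrite oner_eq0.
have nz01 x : (x != 0 :> C) || (1 != 0 :> C) by rewrite oner_eq0 orbT.
have phi_inf : ratmap_eval phi (pt 1 0) = b.
  by rewrite phiE // !mulr1 !mulr0 !addr0 pt_scale ?oppr_eq0.
have phi0 : ratmap_eval phi (pt 0 1) = z.
  by rewrite phiE // !mulr1 !mulr0 !add0r pt_scale.
have phi_m1 : ratmap_eval phi (pt (- 1) 1) = y.
  by rewrite phiE // Dy -[in RHS](pt_scale _ _ bzd); congr pt; rewrite /k1 /k2; ring.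
have h_inf : ratmap_eval h (pt 1 0) = pt 1 0 by apply: phiI; rewrite hf phi_inf fixb.
have h_m1 : ratmap_eval h (pt (- 1) 1) = pt 1 0 by apply: phiI; rewrite hf phi_m1 fy phi_inf.
have h_fib w : ratmap_eval h w = ratmap_eval h (pt 0 1) -> w = pt 0 1.
  move=> hw; apply: phiI; rewrite phi0; apply: (critical_fiber qf crit).
  by rewrite -hf hw hf phi0.
have hE x x' : (x != 0) || (x' != 0) -> ratmap_eval h (pt x x') =
    pt (hform 2 (num h) x x') (hform 2 (den h) x x') by exact: ratmap_eval_pt.
have nzh x x' := @hform_neq0 C h 2 x x' qh.
move: h_inf h_m1 h_fib (nzh 1 0 nz10); rewrite !hE //.
set n0 := (num h)`_0; set n1 := (num h)`_1; set n2 := (num h)`_2.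
set d0 := (den h)`_0; set d1 := (den h)`_1; set d2 := (den h)`_2.
have hnE x x' : hform 2 (num h) x x' = n2 * x ^+ 2 + n1 * x * x' + n0 * x' ^+ 2 by exact: hform2.
have hdE x x' : hform 2 (den h) x x' = d2 * x ^+ 2 + d1 * x * x' + d0 * x' ^+ 2 by exact: hform2.
move=> /eq_pt-/(_ (nzh _ _ nz10) nz10) e1.
move=> /eq_pt-/(_ (nzh _ _ (nz01 _)) nz10) e2 h_fib.
have d2_0 : d2 = 0.
  transitivity (1 * hform 2 (den h) 1 0); first by rewrite hdE; ring.
  by rewrite -e1; ring.
have d01 : d1 = d0.
  apply/esym; apply: subr0_eq; transitivity (1 * hform 2 (den h) (- 1) 1).
    by rewrite hdE d2_0; ring.
  by rewrite -e2; ring.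
have -> : hform 2 (den h) 1 0 = 0 by rewrite hdE d2_0; ring.
have -> : hform 2 (num h) 1 0 = n2 by rewrite hnE; ring.
rewrite eqxx orbF => nzn2.
have nzd0 : d0 != 0.
  apply/eqP=> d0_0; have : pt 1 0 = pt 0 1 :> P1 C.
    apply: h_fib; rewrite !hE // !hdE d2_0 d01 d0_0 !mul0r !addr0.
    by rewrite /pt eqxx.
  by rewrite /pt eqxx oner_eq0.
have n01 : n1 = n0.
  (* The form whose zeros are the fibre through 0 is n2 x^2 + (n1 - n0) x y up to
     a factor; its other zero must be 0 again. *)
  have nzw : (n0 - n1 != 0) || (n2 != 0) by rewrite nzn2 orbT.
  have Fw : hform 2 (num h) (n0 - n1) n2 = n2 * (n0 - n1 + n2) * n0 by rewrite hnE; ring.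
  have Gw : hform 2 (den h) (n0 - n1) n2 = n2 * (n0 - n1 + n2) * d0.
    by rewrite hdE d2_0 d01; ring.
  have nzk : n2 * (n0 - n1 + n2) != 0.
    by have := nzh _ _ nzw; apply: contraTneq => k0; rewrite Fw Gw k0 !mul0r eqxx.
  have : pt (n0 - n1) n2 = pt 0 1.
    apply: h_fib; rewrite !hE // Fw Gw pt_scale // hnE hdE.
    by rewrite !(mulr0, expr1n, mulr1, expr0n, add0r).
  move/eq_pt => /(_ nzw (nz01 _)); rewrite mulr1 mul0r => /eqP.
  by rewrite subr_eq0 => /eqP.
pose t := d0 / n2; pose c := n2 * n0 / d0 ^+ 2.
have nzs : n2 * d0 - 0 * 0 != 0 by rewrite mulr0 subr0 mulf_neq0.
have [psi [mpsi psiE]] := mk_mobius nzs.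
have hnf w : ratmap_eval psi (ratmap_eval h w) = ratmap_eval (normal_form t c) (ratmap_eval psi w).
  have [x [x' [nzx ->]]] := pt_surj w.
  rewrite hE // !psiE ?nzh // nf_pt ?(linear_neq0 nzs) // hnE hdE d2_0 d01 n01.
  congr pt; rewrite /c /t; field; rewrite ?nzn2 ?nzd0 //.
have Etc : (curve_poly C n).[c%:P].[t] = 0.
  have itm1 : iter n (ratmap_eval h) (pt 0 1) = pt (- 1) 1.
    by apply: phiI; rewrite (iter_conj _ _ hf) phi0 phi_m1.
  have := iter_conj n (pt 0 1) hnf; rewrite itm1 !psiE //.
  rewrite !(mulr0, mul0r, mulr1, addr0, add0r) mulrN1.
  have -> : pt 0 d0 = Some 0 by rewrite /pt (negPf nzd0) mul0r.
  have [nzAB ->] := nf_orbit t c n.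
  set A := (orbit_poly C n).1.[c%:P].[t] in nzAB *.
  set B := (orbit_poly C n).2.[c%:P].[t] in nzAB *.
  move=> /eq_pt-/(_ _ nzAB); rewrite nzd0 orbT => /(_ isT) eAB.
  have -> : (curve_poly C n).[c%:P].[t] = B + t * A by rewrite /curve_poly !hornerE.
  apply: (mulfI nzn2); rewrite mulr0 mulrDr.
  have -> : n2 * (t * A) = A * d0 by rewrite /t; field.
  by rewrite -eAB; ring.
exists t, c; split=> //; apply/moduli_classP => //; first exact: quadratic_nf.
apply: (@conjugate_trans _ _ h); first by apply: conjugate_sym; exists phi.
by exists psi.
Qed.

End NormalForm.

(** * The symmetric functions of the multipliers of the normal form *)

Section SigmaOfNormalForm.
Variable C : closedFieldType.
Implicit Types (t c : C).

(** Here [S] is the sum of the multipliers of the two fixed points other than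
    infinity, and the last parenthesis is their product; [t] is the multiplier at
    infinity. *)
Definition sigma_nf (i : 'I_2) : {poly {poly C}} :=
  let t : {poly {poly C}} := 'X%:P in let c : {poly {poly C}} := 'X in
  let S := 2%:R + 4%:R * t * c - t * (1 + t * c) ^+ 2 in
  if i == ord0 then t + S
  else t * S + (2%:R * (2%:R - t) * c - (t * c) ^+ 2).

Lemma horner_sigma_nf t c i : let S := 2%:R + 4%:R * t * c - t * (1 + t * c) ^+ 2 in
  (sigma_nf i).[c%:P].[t] =
  if i == ord0 then t + S else t * S + (2%:R * (2%:R - t) * c - (t * c) ^+ 2).
Proof.
by rewrite /sigma_nf; case: ifP => _;
   rewrite !(hornerD, hornerN, hornerM, hornerX, hornerC, horner_exp, hornerMn).
Qed.

(** At a finite fixed point [a] the multiplier is [(1 - u ^ 2) / t] where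
    [u = 1 / (1 + t a)]; the elementary symmetric functions of the two values of
    [u] are [2 - t - t^2 c] and [1 - t]. *)
Lemma sigma12_nf t c : t != 0 ->
  sigma12 (normal_form t c) = fun i => (sigma_nf i).[c%:P].[t].
Proof.
move=> nzt; set f := normal_form t c; have qf := quadratic_nf t c.
suff [s1 s2] : let S := 2%:R + 4%:R * t * c - t * (1 + t * c) ^+ 2 in
    sigma 1 f = t + S /\ sigma 2 f = t * S + (2%:R * (2%:R - t) * c - (t * c) ^+ 2).
  by apply/funext=> -[[|[|//]] lti]; rewrite horner_sigma_nf /sigma12 /=.
have minf : multiplier f None = t.
  by rewrite multiplier_infty // num_nf den_nf !coef_Poly /= expr1n divr1; ring.
have mfin a : multiplier f (Some a) =
    (a *+ 2 + t * a ^+ 2) / (1 + t * a) ^+ 2.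
  have [sn sd] := quadratic_size qf.
  rewrite /= /wronskian !hornerE !deriv_size3 // !horner_size3 // num_nf den_nf.
  by rewrite !coef_Poly /=; congr (_ / _); ring.
have [r [Fr nzl ler fE]] := fixed_points_roots qf.
set l := lead_coef _ in Fr nzl; set F := num f - _ in Fr.
have F3 : F`_3 = 0 by rewrite /F coefB coefXM num_nf den_nf !coef_Poly /= subrr.
have F2 : F`_2 = 1 - t by rewrite /F coefB coefXM num_nf den_nf !coef_Poly.
have F1 : F`_1 = c * t - 1 by rewrite /F coefB coefXM num_nf den_nf !coef_Poly.
have F0 : F`_0 = c by rewrite /F coefB coefXM num_nf den_nf !coef_Poly /= subr0.
move: F3 F2 F1 F0; rewrite Fr !coefZ {Fr F}.
case: r ler fE => [|a [|b [|d [|//]]]] _ fE.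
(* The cases r = [::], r = [:: a] are t = 1: infinity is a multiple fixed point. *)
- rewrite big_nil !coef1 /= !mulr0 => _ t1 c1 _.
  have Dt : t = 1 by apply/esym/subr0_eq.
  have Dc : c = 1 by move: c1; rewrite Dt mulr1 => /esym/subr0_eq.
  have [-> ->] := sigma_of_multipliers qf (f_equal (map (multiplier f)) fE).
  by rewrite minf Dt Dc; split; ring.
- have -> : \prod_(z <- [:: a]) ('X - z%:P) = Poly [:: - a; 1].
    by rewrite big_seq1 /= !cons_poly_def !(polyCN, polyCD, polyCM); ring.
  rewrite !coef_Poly /= !mulr0 mulr1 mulrN => _ t1 Dl Dla.
  have Dt : t = 1 by apply/esym/subr0_eq.
  have Dc : c = l + 1 by rewrite Dl Dt; ring.
  have lp : l * (1 + a) = - 1 by rewrite mulrDr mulr1 -[l * a]opprK Dla Dc; ring.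
  have [-> ->] := sigma_of_multipliers qf (f_equal (map (multiplier f)) fE).
  have nzp : 1 + a != 0.
    by apply: contra_eq_neq lp => ->; rewrite mulr0 eq_sym oppr_eq0 oner_eq0.
  have -> : multiplier f (Some a) = 1 - l ^+ 2.
    rewrite mfin Dt mul1r; have -> : l = - (1 + a)^-1.
      by apply: (mulIf nzp); rewrite lp mulNr mulVf.
    by field.
  by rewrite minf Dt Dc; split; ring.
- have -> : \prod_(z <- [:: a; b]) ('X - z%:P) = Poly [:: a * b; - (a + b); 1].
    rewrite !big_cons big_nil /= !cons_poly_def !(polyCN, polyCD, polyCM); ring.
  rewrite !coef_Poly /= mulr1 mulrN => _ Dl Ds Dp.
  have [-> ->] := sigma_of_multipliers qf (f_equal (map (multiplier f)) fE).
  (* This evaluates the fixed-point equation at the pole -1/t; it shows that u at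
     one finite fixed point is l times 1 + t y at the other one y. *)
  have lpq : l * (1 + t * a) * (1 + t * b) = 1.
    transitivity (l - t * - (l * (a + b)) + t ^+ 2 * (l * (a * b))); first by ring.
    by rewrite Ds Dp Dl; ring.
  have spq : l * (1 + t * a) + l * (1 + t * b) = 2%:R - t - t ^+ 2 * c.
    transitivity (2%:R * l - t * - (l * (a + b))); first by ring.
    by rewrite Ds Dl; ring.
  rewrite minf !mfin; set p := 1 + t * a in lpq spq *; set q := 1 + t * b in lpq spq *.
  have [nzp nzq] : p != 0 /\ q != 0.
    by split; apply: contra_eq_neq lpq => ->; rewrite !(mulr0, mul0r) eq_sym oner_eq0.
  have -> : (a *+ 2 + t * a ^+ 2) / p ^+ 2 = (1 - (l * q) ^+ 2) / t.
    have -> : l * q = p^-1 by apply: (mulIf nzp); rewrite mulVf // -lpq; ring.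
    by rewrite /p; field; rewrite nzt nzp.
  have -> : (b *+ 2 + t * b ^+ 2) / q ^+ 2 = (1 - (l * p) ^+ 2) / t.
    have -> : l * p = q^-1 by apply: (mulIf nzq); rewrite mulVf.
    by rewrite /q; field; rewrite nzt nzq.
  have sq : (l * p) ^+ 2 + (l * q) ^+ 2 = (2%:R - t - t ^+ 2 * c) ^+ 2 - 2%:R * (1 - t).
    transitivity ((l * p + l * q) ^+ 2 - 2%:R * (l * (l * p * q))); first by ring.
    by rewrite lpq spq Dl; ring.
  have pq : (l * p) * (l * q) = 1 - t.
    transitivity (l * (l * p * q)); first by ring.
    by rewrite lpq Dl mulr1.
  have S1 : (1 - (l * q) ^+ 2) / t + (1 - (l * p) ^+ 2) / t
      = 2%:R + 4%:R * t * c - t * (1 + t * c) ^+ 2.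
    transitivity ((2%:R - ((l * p) ^+ 2 + (l * q) ^+ 2)) / t); first by field.
    by rewrite sq; field.
  have S2 : (1 - (l * q) ^+ 2) / t * ((1 - (l * p) ^+ 2) / t)
      = 2%:R * (2%:R - t) * c - (t * c) ^+ 2.
    transitivity ((1 - ((l * p) ^+ 2 + (l * q) ^+ 2) + (l * p * (l * q)) ^+ 2) / t ^+ 2).
      by field.
    by rewrite sq pq; field.
  by rewrite -S1 -S2; split; ring.
rewrite !big_cons big_nil mulr1 => F3 _ _ _; exfalso; move: F3 nzl.
have -> : ('X - a%:P) * (('X - b%:P) * ('X - d%:P)) =
    Poly [:: - (a * b * d); a * b + a * d + b * d; - (a + b + d); 1].
  rewrite /= !cons_poly_def !(polyCN, polyCD, polyCM); ring.
by rewrite coef_Poly /= mulr1 => ->; rewrite eqxx.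
Qed.

End SigmaOfNormalForm.

(** * Irreducibility *)

Section Irreducibility.
Variable C : closedFieldType.

Lemma meval_horner (S : 'I_2 -> {poly {poly C}}) (P : {mpoly C[2]}) :
  exists A : {poly {poly C}}, forall t c,
    A.[c%:P].[t] = P.@[fun i => (S i).[c%:P].[t]].
Proof.
exists (\sum_(m <- msupp P) (P@_m)%:P%:P * \prod_i S i ^+ m i) => t c.
rewrite mevalE !horner_sum; apply: eq_bigr => m _.
rewrite !hornerM !hornerC !horner_prod; congr (_ * _).
by apply: eq_bigr => i _; rewrite !horner_exp.
Qed.

(** On the curve [E_n = 0], [sigma_1] and [sigma_2] are polynomials in [t] and
    [c], so two proper closed subsets of [V] are cut out by polynomials not
    vanishing identically on the curve, and the irreducibility of the curve
    gives a point outside both. *)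
Lemma irreducible_V n : (0 < n)%N -> irreducible (V C n.+1 1).
Proof.
case: n => // n _; set E := curve_poly C n.+1.
have [sE lcE] := curve_poly_top C n.
have E1 := (orbit_poly_mod_t C n.+1).2.
have nzE t : fiber t E != 0 by exact: curve_poly_fiber_neq0.
have ltE : (1 < size E)%N by rewrite sE ltnS expn_gt0.
have irrE A B := @irreducible_plane_curve C E A B ltE E1 lcE nzE.
have tE t c : E.[c%:P].[t] = 0 -> t != 0.
  move=> Etc; apply/eqP=> t0; have := congr1 (fun P => P.[c]) E1.
  by rewrite fiber_horner -t0 Etc hornerC => /esym/eqP; rewrite oner_eq0.
split.
  have [t [c Etc]] : exists t c, E.[c%:P].[t] = 0.
    have nzl : lead_coef E != 0 by rewrite lead_coef_eq0 -size_poly_gt0 ltnW.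
    have /closed_nonrootP[t lt] := nzl.
    have /closed_rootP[c] : size (fiber t E) != 1.
      by rewrite size_map_poly_id0 ?neq_ltn ?ltE ?orbT.
    by rewrite rootE fiber_horner => /eqP Etc; exists t, c.
  by exists (moduli_class (normal_form t c)); exact: nf_in_V.
case=> A [B [[Z1 [S1 ->] ->] [Z2 [S2 ->] ->] neA neB AB]].
have proper (S : set {mpoly C[2]}) : let Z := [set moduli_class f | f in
        [set f | quadratic f /\ zero_locus S (sigma12 f)]]%classic in
    (V C n.+2 1 `&` Z)%classic <> V C n.+2 1 ->
  exists2 P : {poly {poly C}}, (exists t c, E.[c%:P].[t] = 0 /\ P.[c%:P].[t] != 0) &
    forall t c, E.[c%:P].[t] = 0 -> P.[c%:P].[t] != 0 ->
      ~ Z (moduli_class (normal_form t c)).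
  move=> Z neZ; apply: contrapT => noP; apply: neZ; apply/seteqP; split=> [X []//|X VX].
  split=> //; have [t [c [Etc DX]]] := V_nf (ltn0Sn n) VX.
  exists (normal_form t c) => //; split=> [|P SP]; first exact: quadratic_nf.
  apply: contrapT => Pnz; apply: noP; have [Q QE] := meval_horner (sigma_nf C) P.
  exists Q; first by exists t, c; split=> //; rewrite QE -sigma12_nf ?(tE _ _ Etc) //; apply/eqP.
  move=> t' c' Etc' Qnz [g [qg gS] eqg].
  have := gS P SP; rewrite (@sigma12_conj _ g (normal_form t' c')) //.
  - by rewrite sigma12_nf ?(tE _ _ Etc') // -QE; apply/eqP.
  - exact: quadratic_nf.
  by apply/moduli_classP => //; exact: quadratic_nf.
have [Q1 Q1nz Q1Z] := proper S1 neA.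
have [Q2 Q2nz Q2Z] := proper S2 neB.
have [t [c [Etc Q1tc Q2tc]]] := irrE Q1 Q2 Q1nz Q2nz.
have := nf_in_V Etc; rewrite AB => -[[_]|[_]].
  exact: Q1Z.
exact: Q2Z.
Qed.

End Irreducibility.

Theorem theorem2 (R : realType) (k : nat) (hk : (2 <= k)%N) :
  irreducible (V R[i] k 1).
Proof. by case: k hk => [|k] // hk; exact: irreducible_V. Qed.
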